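(* Let $I=[a,b]\subset\mathbb{R}$ with $a<b$. Then for every integer $n\ge1$ and $x\in\mathbb{R}\setminus\{a,b\}$, $$(-\Delta)^{1/2}[\tilde{T}^I_n](x)=\frac{2n}{b-a}V^I_n(x),$$ and for every integer $n\ge 0$ and $x\in\mathbb{R}\setminus\{a,b\}$, $$(-\Delta)^{1/2}[W^I_n](x)=\frac{2(n+1)}{b-a}\tilde{U}^I_n(x).$$
   Context: $T_n,U_n$ are Chebyshev polynomials of the first and second kind, and $(1-x^2)_+^{\pm1/2}=0$ for $|x|\ge1$. $W_n(x)=(1-x^2)_+^{1/2}U_n(x)$ and $V_n(x)=(1-x^2)_+^{-1/2}T_n(x)$. $\tilde{T}_n(x)=T_n(x)$ for $|x|\le1$ and $\tilde{T}_n(x)=(x-\mathrm{sgn}(x)\sqrt{x^2-1})^n$ for $|x|>1$. $\tilde{U}_{-2}(x)=\tilde{U}_{-1}(x)=0$ for $|x|\le1$; for $|x|>1$, $\tilde{U}_{-2}(x)=-\frac{|x|}{\sqrt{x^2-1}}$ and $\tilde{U}_{-1}(x)=-\frac{\mathrm{sgn}(x)}{\sqrt{x^2-1}}$. $\tilde{U}_0=\tilde{T}_0+\tilde{U}_{-2}$, and $\tilde{U}_n=2\tilde{T}_n+\tilde{U}_{n-2}$ for $n\ge1$. For an interval $I=[a,b]$ and $y=\frac{2}{b-a}\left(x-\frac{a+b}{2}\right)$, set $\tilde{T}^I_n(x)=\tilde{T}_n(y)$, $\tilde{U}^I_n(x)=\tilde{U}_n(y)$, $W^I_n(x)=W_n(y)$,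 $V^I_n(x)=V_n(y)$. For Schwartz $\phi$, $(-\Delta)^{1/2}\phi(x)=\frac1\pi\,\mathrm{p.v.}\!\int_{\mathbb{R}}\frac{\phi(x)-\phi(y)}{|x-y|^2}\,\mathrm{d}y$; for $u\in L^2(\mathbb{R})$, $(-\Delta)^{1/2}u$ is the distribution with $\langle(-\Delta)^{1/2}u,\phi\rangle=\int_{\mathbb{R}}u\,(-\Delta)^{1/2}\phi\,\mathrm{d}x$ for all Schwartz $\phi$, identified with a function when it is given by one (the right-hand sides above being functions defined off the endpoints). *)

(* Defs.v *)
From mathcomp Require Import all_boot all_order all_algebra.
From mathcomp Require Import all_classical all_reals all_analysis.

Set Implicit Arguments.
Unset Strict Implicit.
Unset Printing Implicit Defensive.

Import Order.TTheory GRing.Theory Num.Theory.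
Import numFieldNormedType.Exports.

Local Open Scope classical_set_scope.
Local Open Scope ring_scope.

Section Chebyshev.
Variable R : realType.

Fixpoint chebyshevT (n : nat) : {poly R} :=
  match n with
  | 0 => 1
  | 1 => 'X
  | (n'.+1 as m).+1 => 2%:P * 'X * chebyshevT m - chebyshevT n'
  end.

Fixpoint chebyshevU (n : nat) : {poly R} :=
  match n with
  | 0 => 1
  | 1 => 2%:P * 'X
  | (n'.+1 as m).+1 => 2%:P * 'X * chebyshevU m - chebyshevU n'
  end.

Definition weight_half (x : R) : R :=
  if `|x| < 1 then Num.sqrt (1 - x ^+ 2) else 0.

Definition weight_mhalf (x : R) : R :=
  if `|x| < 1 then (Num.sqrt (1 - x ^+ 2))^-1 else 0.

Definition chebW (n : nat) (x : R) : R := weight_half x * (chebyshevU n).[x].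

Definition chebV (n : nat) (x : R) : R := weight_mhalf x * (chebyshevT n).[x].

Definition Ttilde (n : nat) (x : R) : R :=
  if `|x| <= 1 then (chebyshevT n).[x]
  else (x - Num.sg x * Num.sqrt (x ^+ 2 - 1)) ^+ n.

Definition Utilde_m2 (x : R) : R :=
  if `|x| <= 1 then 0 else - (`|x| / Num.sqrt (x ^+ 2 - 1)).

Definition Utilde_m1 (x : R) : R :=
  if `|x| <= 1 then 0 else - (Num.sg x / Num.sqrt (x ^+ 2 - 1)).

Fixpoint Utilde (n : nat) (x : R) : R :=
  match n with
  | 0 => Ttilde 0 x + Utilde_m2 x
  | 1 => 2 * Ttilde 1 x + Utilde_m1 x
  | n'.+2 => 2 * Ttilde n x + Utilde n' x
  end.

Definition to_unit (a b x : R) : R := 2 / (b - a) * (x - (a + b) / 2).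

Definition TtildeI (a b : R) (n : nat) (x : R) : R := Ttilde n (to_unit a b x).
Definition UtildeI (a b : R) (n : nat) (x : R) : R := Utilde n (to_unit a b x).
Definition chebWI (a b : R) (n : nat) (x : R) : R := chebW n (to_unit a b x).
Definition chebVI (a b : R) (n : nat) (x : R) : R := chebV n (to_unit a b x).

End Chebyshev.

Section HalfLaplacian.
Variable R : realType.
Notation mu := (@lebesgue_measure R).

(* Real-valued test functions suffice: all distributions considered are real,
   so complex test functions are covered by linearity. *)
Definition schwartz (phi : R -> R) : Prop :=
  (forall (n : nat) (x : R), derivable (derive1n n phi) x 1) /\
  (forall m n : nat, exists C : R, forall x : R,
     `|x| ^+ m * `|derive1n n phi x| <= C).

Definition half_laplacian (phi : R -> R) (x : R) : R :=
  pi^-1 *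
  lim ((\int[mu]_(y in [set y | eps < `|x - y|])
          ((phi x - phi y) / `|x - y| ^+ 2)) @[eps --> 0^'+]).

Definition half_laplacian_dist (u phi : R -> R) : R :=
  \int[mu]_x (u x * half_laplacian phi x).

Definition dist_given_by (L : (R -> R) -> R) (f : R -> R) : Prop :=
  locally_integrable setT f /\
  forall phi : R -> R, schwartz phi ->
    mu.-integrable setT (EFin \o (fun x => f x * phi x)) /\
    L phi = \int[mu]_x (f x * phi x).

(* A function giving a distribution is only determined almost everywhere, so
   "the half-Laplacian of u equals g on D" means that u is square integrable
   (so that the distribution is defined) and that the distribution is given by
   a function taking the values g x at all points x of D. *)
Definition half_laplacian_eq_on (D : set R) (u g : R -> R) : Prop :=
  u \in Lfun mu 2%:E /\
  exists f : R -> R, dist_given_by (half_laplacian_dist u) f /\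
    forall x, D x -> f x = g x.

End HalfLaplacian.

(* Main.v *)
Require Import Defs.
From mathcomp Require Import all_boot all_order all_algebra.
From mathcomp Require Import all_classical all_reals all_analysis.
From mathcomp Require Import measurable_realfun complex ring lra.

(* On the upper half-plane, w(z) = z - sqrt(z^2 - 1) (the inverse Joukowski map)
   is holomorphic with |w| <= 1, and on the real axis Ttilde_n = Re w^n and
   W_n = - Im w^(n+1).

   Poisson extension: the Cauchy transforms C_n(z) of W_n satisfy
   C_(n+1) = 2 z C_n - C_(n-1) with C_1 = 2 z C_0 - pi, because the integral of
   W_n is pi/2 for n = 0 and 0 otherwise.  As 2 z = w + 1/w and the C_n are
   bounded in n, only the solution C_n = pi w^(n+1) survives.  So the Poisson
   integral of W_n at x + i e is - Im w(x + i e)^(n+1), and Re w^(n+1) is the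
   convolution of W_n with the conjugate kernel; since the Poisson kernel P_e
   maps the conjugate kernel Q_d to Q_(e+d), letting d -> 0 shows that the
   Poisson integral of Ttilde_n is Re w^n.

   Half-Laplacian: for u bounded with Poisson integrals u_e,
   (- Delta)^(1/2) u = lim (u - u_e) / e in the sense of distributions, because
   (phi - P_e * phi) / e is the integral of the second difference of phi
   against 1 / (2 pi (t^2 + e^2)), which is dominated by the one against
   1 / (2 pi t^2).  The difference quotient of w along x + i e is bounded by
   2 / sqrt |x^2 - 1| and tends to - i w / sqrt (x^2 - 1), which gives V_n and
   Utilde_n. *)

(** The operator is the Dirichlet-to-Neumann map of the half-plane: it sends boundary values to
    minus the normal derivative of their Poisson extension. When the extension is the real or
    imaginary part of a power of w, both formulas come down to w' = - w / sqrt(z^2 - 1). Hence the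
    detour through the conjugate kernel, taken at a height d > 0 where Q_d is bounded. Q_d is not
    integrable either, so its convolution with P_e is found from partial fractions in which
    conjugate kernels occur only through an integrable difference. At the endpoints the slopes blow
    up like |x^2 - 1|^(-1/2), which is locally integrable but unbounded. Limits are therefore taken
    under the integral by domination, almost everywhere, and the endpoints drop out. Square
    integrability is what excludes Ttilde_0 = 1. *)

Set Implicit Arguments.
Unset Strict Implicit.
Unset Printing Implicit Defensive.

Import Order.TTheory GRing.Theory Num.Theory.
Import numFieldNormedType.Exports.

Local Open Scope classical_set_scope.
Local Open Scope ring_scope.

(** * Integrable functions on the line *)

Section L1.
Variable R : realType.
Notation mu := (@lebesgue_measure R).
Implicit Types f g h : R -> R.

Definition L1 f := mu.-integrable setT (EFin \o f).

Lemma L1_measurable f : L1 f -> measurable_fun setT f.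
Proof. by move=> /measurable_int /measurable_EFinP. Qed.

Lemma le_L1 f g : measurable_fun setT f -> (forall x, `|f x| <= g x) ->
  L1 g -> L1 f.
Proof.
move=> mf fg; apply: le_integrable => //; first exact/measurable_EFinP.
by move=> x _ /=; rewrite lee_fin (le_trans (fg x)) ?ler_norm.
Qed.

Lemma eq_L1 f g : f =1 g -> L1 f -> L1 g.
Proof. by move=> /funext ->. Qed.

Lemma L1D f g : L1 f -> L1 g -> L1 (fun x => f x + g x).
Proof. by move=> /integrableD /[apply] => /(_ measurableT). Qed.

Lemma L1B f g : L1 f -> L1 g -> L1 (fun x => f x - g x).
Proof. by move=> /integrableB /[apply] => /(_ measurableT). Qed.

Lemma L1Zl (k : R) f : L1 f -> L1 (fun x => k * f x).
Proof. by move=> /(integrableZl measurableT k). Qed.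

Lemma L1_norm f : L1 f -> L1 (fun x => `|f x|).
Proof. by move=> /integrable_norm. Qed.

Lemma L1M_bounded (M : R) h f : measurable_fun setT h ->
  (forall x, `|h x| <= M) -> L1 f -> L1 (fun x => h x * f x).
Proof.
move=> mh hM fL.
apply: (@le_L1 _ (fun x => M * `|f x|)).
- by apply: measurable_funM => //; exact: L1_measurable.
- by move=> x; rewrite normrM ler_wpM2r.
- exact/L1Zl/L1_norm.
Qed.

Lemma IntD f g : L1 f -> L1 g ->
  \int[mu]_x (f x + g x) = \int[mu]_x f x + \int[mu]_x g x.
Proof. by move=> fL gL; rewrite RintegralD. Qed.

Lemma IntB f g : L1 f -> L1 g ->
  \int[mu]_x (f x - g x) = \int[mu]_x f x - \int[mu]_x g x.
Proof. by move=> fL gL; rewrite RintegralB. Qed.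

Lemma IntZl (k : R) f : L1 f -> \int[mu]_x (k * f x) = k * \int[mu]_x f x.
Proof. by move=> fL; rewrite RintegralZl. Qed.

Lemma eq_Int f g : f =1 g -> \int[mu]_x f x = \int[mu]_x g x.
Proof. by move=> fg; apply: eq_Rintegral => x _. Qed.

Lemma le_Int f g : L1 f -> L1 g -> (forall x, f x <= g x) ->
  \int[mu]_x f x <= \int[mu]_x g x.
Proof. by move=> fL gL fg; apply: le_Rintegral. Qed.

Lemma normr_Int f g : L1 f -> L1 g -> (forall x, `|f x| <= g x) ->
  `|\int[mu]_x f x| <= \int[mu]_x g x.
Proof.
move=> fL gL fg; apply: le_trans (le_normr_Rintegral measurableT fL) _.
by apply: le_Rintegral => //; exact: L1_norm.
Qed.

Lemma EFin_Int f : L1 f ->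
  (\int[mu]_x f x)%R%:E = (\int[mu]_x (f x)%:E)%E.
Proof. by move=> fL; rewrite /Rintegral fineK//; exact: integrable_fin_num. Qed.

Lemma L1_ge0P f : measurable_fun setT f -> (forall x, 0 <= f x) ->
  (\int[mu]_x (f x)%:E < +oo)%E -> L1 f.
Proof.
move=> mf f0 foo; apply/integrableP; split; first exact/measurable_EFinP.
by under eq_integral do rewrite /= ger0_norm//.
Qed.

Lemma aeS (P Q : R -> Prop) : (forall x, P x -> Q x) ->
  {ae mu, forall x, P x} -> {ae mu, forall x, Q x}.
Proof. by move=> PQ; apply: negligibleS => x /=; exact: contra_not (PQ x). Qed.

(** Dominated convergence for real-valued integrals. Convergence and domination are asked only
    almost everywhere, since both may fail at the endpoints of the interval. *)
Lemma Int_cvg (f_ : nat -> R -> R) f g :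
  (forall n, measurable_fun setT (f_ n)) -> measurable_fun setT f ->
  {ae mu, forall x, f_ n x @[n --> \oo] --> f x} ->
  L1 g -> {ae mu, forall x, forall n, `|f_ n x| <= g x} ->
  L1 f /\ (\int[mu]_x f_ n x) @[n --> \oo] --> \int[mu]_x f x.
Proof.
move=> mf_ mf f_f gL f_g.
have mEf_ n : measurable_fun setT (EFin \o f_ n) by exact/measurable_EFinP.
have mEf : measurable_fun setT (EFin \o f) by exact/measurable_EFinP.
have Ef_f : {ae mu, forall x, setT x -> (EFin \o f_ n) x @[n --> \oo] --> (EFin \o f) x}.
  by apply: aeS f_f => x fx _; apply: cvg_EFin => //; exact: nearW.
have Ef_g : {ae mu, forall x n, setT x -> (`|(EFin \o f_ n) x| <= (EFin \o g) x)%E}.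
  by apply: aeS f_g => x fx n _ /=; rewrite lee_fin.
have [] := @dominated_convergence _ _ _ mu setT measurableT _ _ _ mEf_ mEf Ef_f gL Ef_g.
move=> fL _ cvgf; split => //.
apply: fine_cvg; rewrite fineK//; exact: integrable_fin_num.
Qed.

(** The majorant [h] gives integrability on the product by Tonelli. Every section is assumed
    integrable, so that the real-valued inner integrals agree everywhere with the extended ones. *)
Lemma Int_fubini (F : R * R -> R) (h : R -> R) :
  measurable_fun setT F ->
  (forall t, L1 (fun x => F (x, t))) ->
  (forall x, L1 (fun t => F (x, t))) ->
  (forall t, \int[mu]_x `|F (x, t)| <= h t) -> L1 h ->
  [/\ L1 (fun t => \int[mu]_x F (x, t)), L1 (fun x => \int[mu]_t F (x, t)) &
  \int[mu]_x (\int[mu]_t F (x, t)) = \int[mu]_t (\int[mu]_x F (x, t))].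
Proof.
move=> mF F1 F2 Fh hL.
have mEF : measurable_fun setT (EFin \o F) by exact/measurable_EFinP.
have iF : (mu \x mu)%E.-integrable setT (EFin \o F).
  apply/(integrable21ltyP mu mu mEF).
  apply: (@le_lt_trans _ _ (\int[mu]_t (h t)%:E)%E); last first.
    exact: integrable_lty hL.
  apply: ge0_le_integral => //.
  - by move=> t _; exact: integral_ge0.
  - have mA : measurable_fun setT (abse \o (EFin \o F)) by exact: measurableT_comp.
    have A0 z : (0 <= (abse \o (EFin \o F)) z)%E by exact: abse_ge0.
    have := @measurable_fun_fubini_tonelli_G _ _ _ _ _ mu _ mA A0.
    rewrite /fubini_G /=. exact.
  - exact: measurable_int hL.
  - move=> t _ /=; rewrite -EFin_Int ?lee_fin//.
    exact: L1_norm (F1 t).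
have GE t : fubini_G mu (EFin \o F) t = (\int[mu]_x F (x, t))%R%:E.
  by rewrite EFin_Int.
have FE x : fubini_F mu (EFin \o F) x = (\int[mu]_t F (x, t))%R%:E.
  by rewrite EFin_Int.
split.
- apply: (@le_L1 _ h) => //.
    apply/measurable_EFinP; rewrite (_ : _ \o _ = fubini_G mu (EFin \o F)).
      exact: measurable_fubini_G iF.
    by apply/funext => t; rewrite GE.
  move=> t; apply: le_trans (Fh t).
  exact: le_normr_Rintegral measurableT (F1 t).
- rewrite /L1 (_ : _ \o _ = fubini_F mu (EFin \o F)).
    exact: integrable_fubini_F iF.
  by apply/funext => x; rewrite FE.
rewrite {1}/Rintegral [in RHS]/Rintegral; congr fine.
transitivity (\int[mu]_x fubini_F mu (EFin \o F) x)%E.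
  by apply: eq_integral => x _; rewrite FE.
transitivity (\int[mu]_x fubini_G mu (EFin \o F) x)%E; first exact: Fubini iF.
by apply: eq_integral => x _; rewrite GE.
Qed.

End L1.

(** * Affine changes of variables *)

Section Affine.
Variable R : realType.
Notation mu := (@lebesgue_measure R).
Variables c d : R.
Hypothesis c0 : c != 0.

Let phi (x : R) : R := c * x + d.

Lemma measurable_affine : measurable_fun setT phi.
Proof. by apply: measurable_funD => //; exact: measurable_funM. Qed.

Let nu : {measure set (measurableTypeR R) -> \bar R} :=
  @measure_function_pushforward__canonical__measure_function_Measure _ _
    (measurableTypeR R) (measurableTypeR R) R mu phi measurable_affine.

Let nc : {nonneg R} := NngNum (normr_ge0 c).

Let m : {measure set (measurableTypeR R) -> \bar R} :=
  mscale nc nu.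

(** Lebesgue measure is determined by its values on half-open intervals. For c < 0 the preimage of
    such an interval is closed at the other end, hence the two cases. *)
Lemma affine_lebesgue (A : set R) : measurable A -> mu A = m A.
Proof.
apply: lebesgue_measure_unique => X [[u v] _ <-] /=.
rewrite /m /nu /= /mscale /= /pushforward.
have -> : phi @^-1` `]u, v] = if 0 < c then `](u - d) / c, (v - d) / c]%classic
          else `[(v - d) / c, (u - d) / c[%classic.
  apply/seteqP; split=> x /=; rewrite ?in_itv/=; case: ifPn => cp; rewrite /= ?in_itv/= /phi.
  - by rewrite ltr_pdivrMr// ler_pdivlMr// ltrBlDr lerBrDr mulrC.
  - have cn : c < 0 by rewrite lt_neqAle c0 leNgt.
    by rewrite ler_ndivrMr// ltr_ndivlMr// ltrBlDr lerBrDr mulrC andbC.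
  - by rewrite ltr_pdivrMr// ler_pdivlMr// ltrBlDr lerBrDr mulrC.
  - have cn : c < 0 by rewrite lt_neqAle c0 leNgt.
    by rewrite ler_ndivrMr// ltr_ndivlMr// ltrBlDr lerBrDr mulrC andbC.
rewrite lebesgue_measure_itv/= lte_fin; case: ifPn => uv; case: ifPn => cp;
  rewrite lebesgue_measure_itv/= lte_fin.
- rewrite ltr_pM2r ?invr_gt0// ltrBlDr subrK uv -EFinB -EFinM gtr0_norm//; congr _%:E.
  by field.
- have cn : c < 0 by rewrite lt_neqAle c0 leNgt.
  rewrite ltr_nM2r ?invr_lt0// ltrBlDr subrK uv -EFinB -EFinM ltr0_norm//; congr _%:E.
  by field.
- by rewrite ltr_pM2r ?invr_gt0// ltrBlDr subrK (negbTE uv) mule0.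
- have cn : c < 0 by rewrite lt_neqAle c0 leNgt.
  by rewrite ltr_nM2r ?invr_lt0// ltrBlDr subrK (negbTE uv) mule0.
Qed.

Lemma ge0_integral_affine (f : R -> R) : measurable_fun setT f -> (forall x, 0 <= f x) ->
  (\int[mu]_x (f x)%:E = `|c|%:E * \int[mu]_x (f (c * x + d))%:E)%E.
Proof.
move=> mf f0.
transitivity (\int[m]_x (f x)%:E)%E.
  by apply: eq_measure_integral => A mA _; exact: affine_lebesgue.
have mEf : measurable_fun setT (EFin \o f) by exact/measurable_EFinP.
rewrite ge0_integral_mscale//=.
  congr (_ * _)%E.
  rewrite ge0_integral_pushforward//=; first exact: measurable_affine.
  by move=> y _; rewrite lee_fin.
by move=> y _; rewrite lee_fin.
Qed.

Lemma L1_affine (f : R -> R) : L1 f -> L1 (fun x => f (c * x + d)).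
Proof.
move=> fL.
have mf := L1_measurable fL.
apply/integrableP; split.
  by apply/measurable_EFinP; exact: (measurableT_comp mf measurable_affine).
have := ge0_integral_affine (measurableT_comp (@normr_measurable _ setT) mf)
  (fun x => normr_ge0 (f x)).
move/integrableP : fL => [_ /=].
move=> + E; rewrite E /=.
case: (integral _ _ _) => [r _| |//]; first by rewrite ltry.
by rewrite mulry gtr0_sg ?normr_gt0// mul1e.
Qed.

Lemma Int_affine (f : R -> R) : L1 f ->
  \int[mu]_x f (c * x + d) = `|c|^-1 * \int[mu]_x f x.
Proof.
have c0' : `|c| != 0 by rewrite normr_eq0.
have pos g : L1 g -> (forall x, 0 <= g x) ->
  \int[mu]_x g (c * x + d) = `|c|^-1 * \int[mu]_x g x.
  move=> gL g0; apply: (mulfI c0'); rewrite mulrA divff// mul1r.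
  have := ge0_integral_affine (L1_measurable gL) g0.
  by rewrite -!EFin_Int ?L1_affine// -EFinM => -[->].
move=> fL.
(* A difference of two nonnegative integrable functions, to which the nonnegative case applies. *)
have fE x : f x = `|f x| - (`|f x| - f x) by ring.
have aL := L1_norm fL.
have bL := L1B aL fL.
transitivity (\int[mu]_x (`|f (c * x + d)| - (`|f (c * x + d)| - f (c * x + d)))).
  by apply: eq_Int => x; rewrite -fE.
rewrite (IntB (L1_affine aL) (L1_affine bL)) (pos _ aL)// (pos _ bL).
  by rewrite -mulrBr -IntB//; congr (_ * _); apply: eq_Int => x; rewrite -fE.
by move=> x; rewrite subr_ge0 ler_norm.
Qed.

End Affine.

Section Translation.
Variable R : realType.
Notation mu := (@lebesgue_measure R).
Implicit Types f : R -> R.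

Lemma L1_translate (d : R) f : L1 f -> L1 (fun x => f (x + d)).
Proof.
by move/(L1_affine d (oner_neq0 _)); apply: eq_L1 => x; rewrite mul1r.
Qed.

Lemma Int_translate (d : R) f : L1 f -> \int[mu]_x f (x + d) = \int[mu]_x f x.
Proof.
move=> /(Int_affine d (oner_neq0 _)); rewrite normr1 invr1 mul1r => <-.
by apply: eq_Int => x; rewrite mul1r.
Qed.

Lemma L1_reflect (d : R) f : L1 f -> L1 (fun x => f (d - x)).
Proof.
have n1 : - 1 != 0 :> R by rewrite oppr_eq0 oner_neq0.
by move/(L1_affine d n1); apply: eq_L1 => x; rewrite mulN1r addrC.
Qed.

Lemma Int_reflect (d : R) f : L1 f -> \int[mu]_x f (d - x) = \int[mu]_x f x.
Proof.
have n1 : - 1 != 0 :> R by rewrite oppr_eq0 oner_neq0.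
move=> /(Int_affine d n1); rewrite normrN1 invr1 mul1r => <-.
by apply: eq_Int => x; rewrite mulN1r addrC.
Qed.

End Translation.

(** * Poisson kernels *)

Section PoissonKernels.
Variable R : realType.
Notation mu := (@lebesgue_measure R).
Implicit Types e d x y : R.

(** Poisson kernel and conjugate kernel without the factor 1 / pi: 1 / (x + i e) = [qker e x] - i
    [pker e x]. This is the source of the factors pi in later formulas. *)
Definition pker (e x : R) : R := e / (x ^+ 2 + e ^+ 2).
Definition qker (e x : R) : R := x / (x ^+ 2 + e ^+ 2).

Lemma sqrD_gt0 (e x : R) : e != 0 -> 0 < x ^+ 2 + e ^+ 2.
Proof. by move=> e0; rewrite ltr_wpDl ?sqr_ge0// exprn_even_gt0. Qed.

Lemma sqrD_neq0 (e x : R) : e != 0 -> x ^+ 2 + e ^+ 2 != 0.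
Proof. by move=> /(sqrD_gt0 x) /lt0r_neq0. Qed.

Lemma continuous_sqrD (e : R) : continuous (fun x : R => x ^+ 2 + e ^+ 2).
Proof. by move=> x; apply: cvgD; [exact: exprn_continuous|exact: cvg_cst]. Qed.

Lemma continuous_pker e : e != 0 -> continuous (pker e).
Proof.
move=> e0 x; apply: cvgM; first exact: cvg_cst.
by apply: cvgV; [exact: sqrD_neq0|exact: continuous_sqrD].
Qed.

Lemma continuous_qker e : e != 0 -> continuous (qker e).
Proof.
move=> e0 x; apply: cvgM; first exact: cvg_id.
by apply: cvgV; [exact: sqrD_neq0|exact: continuous_sqrD].
Qed.

Lemma measurable_pker e : e != 0 -> measurable_fun setT (pker e).
Proof. by move=> e0; apply: continuous_measurable_fun; exact: continuous_pker. Qed.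

Lemma measurable_qker e : e != 0 -> measurable_fun setT (qker e).
Proof. by move=> e0; apply: continuous_measurable_fun; exact: continuous_qker. Qed.

Lemma pker_ge0 e x : 0 < e -> 0 <= pker e x.
Proof. by move=> e0; rewrite /pker divr_ge0 ?ltW// sqrD_gt0// gt_eqF. Qed.

Lemma pkerN e x : pker e (- x) = pker e x.
Proof. by rewrite /pker sqrrN. Qed.

Lemma qker_le e x : 0 < e -> `|qker e x| <= (2 * e)^-1.
Proof.
move=> e0; have A0 := sqrD_gt0 x (lt0r_neq0 e0).
rewrite /qker normrM normfV [`|_ + _|]gtr0_norm// ler_pdivrMr//.
rewrite ler_pdivlMl ?mulr_gt0//.
rewrite -(@real_normK _ x) ?num_real//.
by have := sqr_ge0 (`|x| - e); nra.
Qed.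

Lemma Int_pker1 : L1 (pker 1) /\ \int[mu]_x pker 1 x = pi.
Proof.
have p0 x : 0 <= pker 1 x by exact: pker_ge0.
have cp := continuous_pker (oner_neq0 R).
have E : (\int[mu]_x (pker 1 x)%:E)%E = (pi : R)%:E.
  rewrite ge0_symfun_integralT//; last by move=> x /=; rewrite pkerN.
  rewrite -set_itvcy (@ge0_continuous_FTC2y _ (pker 1) atan 0 (pi / 2))//.
  - by rewrite atan0 -EFinB -EFinM; congr _%:E; field.
  - exact: continuous_subspaceT.
  - exact: cvgy_atan.
  - by apply: cvg_at_right_filter; exact: continuous_atan.
  - by move=> x _; rewrite derive1_atan /pker expr1n addrC mul1r.
split; last by rewrite /Rintegral E.
apply: L1_ge0P => //; last by rewrite E ltry.
by apply: measurable_pker; exact: oner_neq0.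
Qed.

Lemma pker_scale e x : 0 < e -> pker e x = e^-1 * pker 1 (e^-1 * x + 0).
Proof.
move=> e0; rewrite /pker addr0; field.
by rewrite lt0r_neq0// sqrD_neq0// lt0r_neq0.
Qed.

Lemma L1_pker e : 0 < e -> L1 (pker e).
Proof.
move=> e0; have e0' : e^-1 != 0 by rewrite invr_eq0 gt_eqF.
apply: eq_L1 (fun x => esym (pker_scale x e0)) _.
exact: L1Zl (L1_affine 0 e0' Int_pker1.1).
Qed.

Lemma Int_pker e : 0 < e -> \int[mu]_x pker e x = pi.
Proof.
move=> e0; have e0' : e^-1 != 0 by rewrite invr_eq0 gt_eqF.
rewrite (eq_Int (fun x => pker_scale x e0)).
rewrite (IntZl _ (L1_affine 0 e0' Int_pker1.1)).
rewrite (Int_affine 0 e0' Int_pker1.1).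
by rewrite Int_pker1.2 gtr0_norm ?invr_gt0// invrK mulrA mulVf ?gt_eqF// mul1r.
Qed.

(** Dominated convergence reduces the integral to the intervals [-n, n]. No sign of [f] is assumed:
    the difference of conjugate kernels to be integrated changes sign. *)
Lemma Int_FTC (f F : R -> R) (l : R) : L1 f -> continuous f ->
  (forall x, is_derive x 1 F (f x)) ->
  (F n%:R - F (- n%:R)) @[n --> \oo] --> l ->
  \int[mu]_x f x = l.
Proof.
move=> fL cf dF Fl.
pose fn n : R -> R := f \_ `[- n%:R, n%:R].
have mfn n : measurable_fun setT (fn n).
  apply/(measurable_restrictT _ _).1 => //.
  by apply: measurable_funTS; exact: L1_measurable.
have fn_f : {ae mu, forall x, fn n x @[n --> \oo] --> f x}.
  apply: aeW => x; apply/cvgrPdist_lt => e e0.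
  exists (Num.trunc `|x|).+1 => // n /= nx; rewrite /fn patchE mem_set.
    by rewrite subrr normr0.
  rewrite /= in_itv/= -ler_norml.
  apply: ltW; rewrite (lt_le_trans (truncnS_gt _))// ler_nat//.
have fn_le : {ae mu, forall x, forall n, `|fn n x| <= `|f x|}.
  apply: aeW => x n; rewrite /fn patchE; case: ifP => // _.
  by rewrite normr0.
have [_ fn_int] := Int_cvg mfn (L1_measurable fL) fn_f (L1_norm fL) fn_le.
have fnE n : \int[mu]_x fn n x = F n%:R - F (- n%:R).
  rewrite -Rintegral_mkcond; case: n => [|n].
    by rewrite oppr0 set_itv1 Rintegral_set1 subrr.
  have dF' x : derivable F x 1 by exact: ex_derive.
  have cF : continuous F.
    by move=> x; apply: differentiable_continuous; apply/derivable1_diffP.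
  rewrite /Rintegral (@continuous_FTC2 _ f F).
  - by rewrite -EFinB.
  - by rewrite ltrNl -subr_gt0 opprK addr_gt0 ?ltr0n.
  - exact: continuous_subspaceT.
  - split; first by move=> x _; exact: dF'.
    + by apply: cvg_at_right_filter; exact: cF.
    + by apply: cvg_at_left_filter; exact: cF.
  - by move=> x _; rewrite derive1E; exact: derive_val.
move: fn_int; rewrite (funext fnE) => fn_int.
exact: (cvg_unique _ fn_int Fl).
Qed.

Lemma cvg_ln_ratio (d e x s : R) : 0 < d -> 0 < e -> s != 0 ->
  ln (((s * n%:R) ^+ 2 + d ^+ 2) / ((s * n%:R - x) ^+ 2 + e ^+ 2)) @[n --> \oo] --> (0 : R).
Proof.
move=> d0 e0 s0; rewrite -cvg_shiftS.
(* The ratio with numerator and denominator divided by (s n)^2, written in u = 1 / (s n); it is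
   continuous at u = 0 with value 1. *)
pose h (u : R) := (1 + d ^+ 2 * u ^+ 2) / ((1 - x * u) ^+ 2 + e ^+ 2 * u ^+ 2).
have -> : (fun n => ln (((s * n.+1%:R) ^+ 2 + d ^+ 2) /
    ((s * n.+1%:R - x) ^+ 2 + e ^+ 2))) = (fun n => ln (h (s^-1 * harmonic n))).
  apply/funext => n; congr ln; rewrite /h /harmonic /=.
  rewrite -invfM; set k := s * _.
  have k0 : k != 0 by rewrite mulf_neq0// pnatr_eq0.
  have -> : 1 + d ^+ 2 * k^-1 ^+ 2 = (k ^+ 2 + d ^+ 2) / k ^+ 2 by field.
  have -> : (1 - x * k^-1) ^+ 2 + e ^+ 2 * k^-1 ^+ 2 =
    ((k - x) ^+ 2 + e ^+ 2) / k ^+ 2 by field.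
  by rewrite invf_div mulrA divfK// expf_neq0.
have h0 : h 0 = 1 by rewrite /h expr0n /= !mulr0 !addr0 subr0 expr1n divr1.
have u0 : (s^-1 * harmonic n) @[n --> \oo] --> (0 : R).
  by rewrite -[X in _ --> X](mulr0 s^-1); apply: cvgM; [exact: cvg_cst|exact: cvg_harmonic].
have ch : h u @[u --> (0 : R)] --> h 0.
  have cX2 (k : R) : (k ^+ 2 * u ^+ 2) @[u --> (0 : R)] --> k ^+ 2 * 0 ^+ 2.
    by apply: cvgM; [exact: cvg_cst|exact: exprn_continuous].
  apply: cvgM; first by apply: cvgD; [exact: cvg_cst|exact: cX2].
  apply: cvgV; first by rewrite expr0n /= !mulr0 addr0 subr0 expr1n oner_neq0.
  apply: cvgD; last exact: cX2.
  have cL : (1 - x * u) @[u --> (0 : R)] --> 1 - x * 0.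
    by apply: cvgB; [exact: cvg_cst|apply: cvgM; [exact: cvg_cst|exact: cvg_id]].
  exact: (cvg_comp _ _ cL (@exprn_continuous _ 2 _)).
have cl : {for h 0, continuous (@ln R)} by apply: continuous_ln; rewrite h0.
have := cvg_comp _ _ (cvg_comp _ _ u0 ch) cl.
by rewrite h0 ln1.
Qed.

Lemma is_derive_ln_sqrD (e x y : R) : 0 < e ->
  is_derive y 1 (fun y => 2^-1 * ln ((y - x) ^+ 2 + e ^+ 2)) (qker e (y - x)).
Proof.
move=> e0.
have A0 := sqrD_gt0 (y - x) (lt0r_neq0 e0).
have dl := is_derive1_ln A0.
have dq : is_derive y 1 (fun y => (y - x) ^+ 2 + e ^+ 2) (2 * (y - x)).
  apply: is_derive_eq.
  by rewrite /GRing.scale /=; ring.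
have := @is_derive1_comp _ (@ln R) (fun y => (y - x) ^+ 2 + e ^+ 2) y _ _ dl dq.
move=> dc.
have := @is_deriveZ _ _ _ _ 2^-1 _ _ _ dc.
rewrite /GRing.scale /= /qker.
congr (is_derive _ _ _ _).
by field; rewrite lt0r_neq0.
Qed.

Lemma continuous_subr (f : R -> R) x : continuous f -> continuous (fun y => f (y - x)).
Proof.
move=> cf y; apply: (@continuous_comp _ _ _ (fun y => y - x) f); last exact: cf.
by apply: cvgB; [exact: cvg_id|exact: cvg_cst].
Qed.

(** Each kernel decays only like 1 / y, but the leading terms cancel and the difference decays like
    1 / y^2. *)
Lemma L1_qkerB d e x : 0 < d -> 0 < e -> L1 (fun y => qker d y - qker e (y - x)).
Proof.
move=> d0 e0.
have dn := lt0r_neq0 d0; have en := lt0r_neq0 e0.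
have Pd := L1_pker d0; have Pe := L1_translate (- x) (L1_pker e0).
(* The first group bounds the term in y (y - x) by the arithmetic-geometric mean inequality, the
   second bounds each product of a [qker] and a [pker] by [qker_le]. *)
pose g y := `|x| * 2^-1 * (d^-1 * pker d y + e^-1 * pker e (y - x))
  + (e * (2 * d)^-1 * pker e (y - x) + d * (2 * e)^-1 * pker d y).
apply: (@le_L1 _ _ g).
- apply: continuous_measurable_fun => y; apply: cvgB; first exact: continuous_qker.
  exact: continuous_subr (continuous_qker en) _.
- move=> y.
  have A0 := sqrD_gt0 y dn; have B0 := sqrD_gt0 (y - x) en.
  have An := lt0r_neq0 A0; have Bn := lt0r_neq0 B0.
  have -> : qker d y - qker e (y - x) =
    - x * (y * (y - x) / ((y ^+ 2 + d ^+ 2) * ((y - x) ^+ 2 + e ^+ 2))) +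
    (e * qker d y * pker e (y - x) - d * qker e (y - x) * pker d y).
    by rewrite /qker /pker; field; rewrite An Bn.
  apply: le_trans (ler_normD _ _) _; apply: lerD.
    rewrite normrM normrN -[`|x| / 2 * _]mulrA ler_wpM2l//.
    rewrite normrM normfV [X in _ / X]gtr0_norm ?mulr_gt0//.
    have -> : 2^-1 * (d^-1 * pker d y + e^-1 * pker e (y - x)) =
      2^-1 * ((y - x) ^+ 2 + e ^+ 2 + (y ^+ 2 + d ^+ 2)) /
      ((y ^+ 2 + d ^+ 2) * ((y - x) ^+ 2 + e ^+ 2)).
      by rewrite /pker; field; rewrite An Bn dn en.
    apply: ler_wpM2r; first by rewrite invr_ge0 ltW// mulr_gt0.
    have := sqr_ge0 (y + (y - x)); have := sqr_ge0 (y - (y - x)).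
    have := sqr_ge0 d; have := sqr_ge0 e.
    by rewrite ler_norml => ? ? ? ?; apply/andP; split; lra.
  apply: le_trans (ler_normB _ _) _; apply: lerD.
    rewrite normrM [`|pker _ _|]ger0_norm ?pker_ge0// normrM gtr0_norm//.
    apply: ler_wpM2r; first exact: pker_ge0.
    by apply: ler_wpM2l; [exact: ltW|exact: qker_le].
  rewrite normrM [`|pker _ _|]ger0_norm ?pker_ge0// normrM gtr0_norm//.
  apply: ler_wpM2r; first exact: pker_ge0.
  by apply: ler_wpM2l; [exact: ltW|exact: qker_le].
- apply: L1D; first by apply: L1Zl; apply: L1D; exact: L1Zl.
  by apply: L1D; exact: L1Zl.
Qed.

(** The antiderivative is half the logarithm of a ratio of quadratics that tends to 1 at both
    ends. *)
Lemma Int_qkerB d e x : 0 < d -> 0 < e ->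
  \int[mu]_y (qker d y - qker e (y - x)) = 0.
Proof.
move=> d0 e0.
have dn := lt0r_neq0 d0; have en := lt0r_neq0 e0.
pose F y := 2^-1 * ln ((y - 0) ^+ 2 + d ^+ 2) - 2^-1 * ln ((y - x) ^+ 2 + e ^+ 2).
have FE y : F y = 2^-1 * ln ((y ^+ 2 + d ^+ 2) / ((y - x) ^+ 2 + e ^+ 2)).
  by rewrite ln_div ?posrE ?sqrD_gt0// /F subr0 mulrBr.
apply: (@Int_FTC _ F).
- exact: L1_qkerB.
- move=> y; apply: cvgB; first exact: continuous_qker.
  exact: continuous_subr (continuous_qker en) _.
- move=> y; have := is_derive_ln_sqrD 0 y d0; rewrite subr0 => h.
  exact: is_deriveB h (is_derive_ln_sqrD x y e0).
- have limF (s : R) : s != 0 -> F (s * n%:R) @[n --> \oo] --> (0 : R).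
    move=> s0; rewrite (funext (fun n : nat => FE (s * n%:R))).
    rewrite -[X in _ --> X](mulr0 2^-1); apply: cvgM; first exact: cvg_cst.
    exact: cvg_ln_ratio.
  rewrite -[0](subrr 0); apply: cvgB.
    by have := limF 1 (oner_neq0 R); under eq_fun do rewrite mul1r.
  have n1 : - 1 != 0 :> R by rewrite oppr_eq0 oner_neq0.
  by have := limF (- 1) n1; under eq_fun do rewrite mulN1r.
Qed.

(* Real part of the partial fractions in y of e / (((y - x)^2 + e^2) (y + i d)). *)
Lemma pker_mul_qker d e x y : 0 < d -> d < e ->
  pker e (y - x) * qker d y =
  2^-1 * ((e - d) / (x ^+ 2 + (e - d) ^+ 2) + pker (e + d) x) *
     (qker d y - qker e (y - x))
  + (2^-1 * (qker (e + d) x - qker (e - d) x) * pker d y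
  + 2^-1 * (qker (e + d) x + qker (e - d) x) * pker e (y - x)).
Proof.
move=> d0 de.
have A0 : y ^+ 2 + d ^+ 2 != 0 by rewrite sqrD_neq0 ?gt_eqF.
have e0 : 0 < e by rewrite (lt_trans d0).
have B0 : (y - x) ^+ 2 + e ^+ 2 != 0 by rewrite sqrD_neq0 ?gt_eqF.
have C0 : x ^+ 2 + (e - d) ^+ 2 != 0 by rewrite sqrD_neq0 ?gt_eqF ?subr_gt0.
have D0 : x ^+ 2 + (e + d) ^+ 2 != 0 by rewrite sqrD_neq0 ?gt_eqF ?addr_gt0.
rewrite /pker /qker; field.
by rewrite A0 B0 C0 D0.
Qed.

(** In the partial fractions the difference of conjugate kernels integrates to 0, and the two
    occurrences of [qker (e - d) x] cancel. The condition d < e keeps the denominator x^2 + (e -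
    d)^2 away from 0. *)
Lemma Int_pker_qker d e x : 0 < d -> d < e ->
  \int[mu]_y (pker e (y - x) * qker d y) = pi * qker (e + d) x.
Proof.
move=> d0 de; have e0 : 0 < e by rewrite (lt_trans d0).
have Pd := L1_pker d0; have Pe := L1_translate (- x) (L1_pker e0).
have Q := L1_qkerB x d0 e0.
rewrite (eq_Int (fun y => pker_mul_qker x y d0 de)).
rewrite (IntD (L1Zl _ Q) (L1D (L1Zl _ Pd) (L1Zl _ Pe))).
rewrite (IntD (L1Zl _ Pd) (L1Zl _ Pe)) (IntZl _ Q) (IntZl _ Pd) (IntZl _ Pe).
rewrite Int_qkerB// Int_pker// (Int_translate (- x) (L1_pker e0)) Int_pker//.
by rewrite mulr0; field.
Qed.

End PoissonKernels.

(** * Test functions *)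

Lemma measurable_inv (R : realType) : measurable_fun setT (@GRing.inv R).
Proof.
rewrite -(setUv [set 0 : R]); apply/measurable_funU => //.
  exact: measurableC.
split; first exact: measurable_fun_set1.
apply: open_continuous_measurable_fun.
  by apply: closed_openC; exact: closed_eq.
move=> x; rewrite inE => x0; apply: inv_continuous.
by apply/eqP.
Qed.

(** * Symmetric second differences *)

Section SecondDifference.
Variable R : realType.
Notation mu := (@lebesgue_measure R).
Implicit Types (phi : R -> R) (x t : R).

(** The opposite of the usual second difference, so that the half-Laplacian is its integral against
    a positive kernel. *)
Definition diff2 phi x t : R := 2 * phi x - phi (x + t) - phi (x - t).

Lemma diff20 phi x : diff2 phi x 0 = 0.
Proof. by rewrite /diff2 addr0 subr0; ring. Qed.

Lemma diff2N phi x t : diff2 phi x (- t) = diff2 phi x t.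
Proof. by rewrite /diff2 opprK; ring. Qed.

Lemma normr_diff2 phi x t : `|diff2 phi x t| <=
  2 * `|phi x| + `|phi (x + t)| + `|phi (x - t)|.
Proof.
rewrite /diff2; apply: le_trans (ler_normB _ _) _; rewrite lerD2r.
by apply: le_trans (ler_normB _ _) _; rewrite lerD2r normrM normr_nat.
Qed.

(** The mean value theorem is used twice, on [diff2 phi x] and then on phi' between x - s and x + s.
    The second derivative is bounded only within distance |t| of x, so that its decay in x is not
    lost. *)
Lemma normr_diff2_le phi (M : R) x t :
  (forall y, derivable phi y 1) -> (forall y, derivable (derive1 phi) y 1) ->
  (forall y, `|y - x| <= `|t| -> `|derive1n 2 phi y| <= M) ->
  `|diff2 phi x t| <= 2 * t ^+ 2 * M.
Proof.
move=> d0 d1.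
wlog t0 : t / 0 <= t.
  move=> h; have [/h//|/ltW t0] := leP 0 t; rewrite -(diff2N _ _ t) -normrN -sqrrN.
  by apply: h; rewrite oppr_ge0.
move=> hM.
have D0 (y : R) : is_derive y 1 phi ((derive1 phi) y) by rewrite derive1E; exact/derivableP.
have D1 (y : R) : is_derive y 1 (derive1 phi) (derive1n 2 phi y).
  by rewrite derive1nS derive1n1 derive1E; apply/derivableP.
have cf (f df : R -> R) a b : (forall y : R, is_derive y 1 f (df y)) ->
    {within `[a, b], continuous f}.
  by move=> dfy; apply: derivable_within_continuous => y _; case: (dfy y).
have Dh (s : R) : is_derive s 1 (diff2 phi x) ((derive1 phi) (x - s) - (derive1 phi) (x + s)).
  have l1 : is_derive s 1 (fun s => x + s) 1 by apply: is_derive_eq; ring.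
  have l2 : is_derive s 1 (fun s => x - s) (- 1) by apply: is_derive_eq; ring.
  have e1 := is_derive1_comp (D0 _) l1.
  have e2 := is_derive1_comp (D0 _) l2.
  have := is_deriveB (is_deriveB (is_derive_cst (2 * phi x) s 1) e1) e2.
  by congr is_derive; ring.
have [s + e] := MVT_segment t0 (fun s _ => Dh s) (cf _ _ 0 t Dh).
rewrite in_itv/= => /andP[s0 st].
move: e; rewrite diff20 !subr0 => ->.
have ss : x - s <= x + s by rewrite lerD2l ge0_cp.
have [y + e] := MVT_segment ss (fun s _ => D1 s) (cf _ _ (x - s) (x + s) D1).
rewrite in_itv/= => /andP[y1 y2].
rewrite -opprB e normrM normrN normrM.
rewrite (ger0_norm t0) (_ : x + s - (x - s) = 2 * s); last by ring.
rewrite [`|2 * s|]ger0_norm ?mulr_ge0//.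
have yM : `|derive1n 2 phi y| <= M.
  by apply: hM; rewrite (ger0_norm t0) ler_norml; apply/andP; split; lra.
have M0 : 0 <= M by exact: le_trans yM.
apply: (@le_trans _ _ (M * (2 * s) * t)).
  by rewrite ler_wpM2r// ler_wpM2r// mulr_ge0.
rewrite [leRHS](_ : _ = M * (2 * t) * t); last by ring.
by rewrite ler_wpM2r// ler_wpM2l// ler_wpM2l.
Qed.

Lemma measurable_diff2 phi : measurable_fun setT phi ->
  measurable_fun setT (fun z : R * R => diff2 phi z.1 z.2).
Proof.
move=> mphi.
apply: measurable_funB; last first.
  by apply: (measurableT_comp mphi); apply: measurable_funB => //; exact: measurable_snd.
apply: measurable_funB.
  by apply: measurable_funM => //; apply: (measurableT_comp mphi).
by apply: (measurableT_comp mphi); apply: measurable_funD => //; exact: measurable_snd.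
Qed.

Lemma measurable_diff2l phi t : measurable_fun setT phi ->
  measurable_fun setT (fun x => diff2 phi x t).
Proof.
move=> mphi; apply: measurable_funB.
  apply: measurable_funB; first exact: measurable_funM.
  by apply: (measurableT_comp mphi); exact: measurable_funD.
by apply: (measurableT_comp mphi); exact: measurable_funB.
Qed.

Lemma measurable_diff2r phi x : measurable_fun setT phi ->
  measurable_fun setT (diff2 phi x).
Proof.
move=> mphi; apply: measurable_funB.
  apply: measurable_funB; first exact: measurable_cst.
  by apply: (measurableT_comp mphi); exact: measurable_funD.
by apply: (measurableT_comp mphi); exact: measurable_funB.
Qed.

End SecondDifference.

(** * Decay of Schwartz functions and of their second differences *)

Section SchwartzDecay.
Variable R : realType.
Notation mu := (@lebesgue_measure R).
Variable phi : R -> R.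
Hypothesis sphi : schwartz phi.

Lemma schwartz_continuous : continuous phi.
Proof.
move=> x; apply: differentiable_continuous; apply/derivable1_diffP.
exact: (sphi.1 0).
Qed.

Lemma schwartz_measurable : measurable_fun setT phi.
Proof. exact: continuous_measurable_fun schwartz_continuous. Qed.

(** Here and below [pker 1 x] = 1 / (1 + x^2) serves as the standard integrable majorant; the
    seminorms of weights 0 and 2 add up to this bound. *)
Lemma schwartz_decay n : exists2 C : R, 0 <= C & forall x, `|derive1n n phi x| <= C * pker 1 x.
Proof.
have [C0 h0] := sphi.2 0%N n; have [C2 h2] := sphi.2 2%N n.
have C00 : 0 <= C0 by apply: le_trans (h0 0); rewrite expr0 mul1r.
have C20 : 0 <= C2 by apply: le_trans (h2 0); rewrite mulr_ge0.
exists (C0 + C2); first by rewrite addr_ge0.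
move=> x; rewrite /pker expr1n mul1r ler_pdivlMr; last by rewrite ltr_wpDl ?sqr_ge0.
have := h0 x; have := h2 x; rewrite expr0 mul1r real_normK ?num_real// => h h'.
by rewrite mulrDr mulr1 mulrC addrC lerD.
Qed.

Lemma schwartz_L1 : L1 phi.
Proof.
have [C C0 hC] := schwartz_decay 0.
apply: le_L1 schwartz_measurable hC _; apply: L1Zl.
exact: (Int_pker1 _).1.
Qed.

Lemma pker1_le1 (x : R) : pker 1 x <= 1.
Proof.
by rewrite /pker expr1n mul1r invf_le1 ?ler_wpDl ?sqr_ge0// ltr_wpDl ?sqr_ge0.
Qed.

(** For |t| <= 1 the second derivative controls the quotient; for |t| > 1 the three values of phi
    do, as 1 / t^2 <= 2 [pker 1 t]. The bound is kept explicit in x because it is used both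
    uniformly in x and integrated over x. *)
Lemma schwartz_diff2_le : exists2 C : R, 0 <= C & forall x t,
  `|diff2 phi x t / t ^+ 2| <=
  (C * pker 1 x + 2 * (2 * `|phi x| + `|phi (x + t)| + `|phi (x - t)|)) * pker 1 t.
Proof.
have [C C0 hC] := schwartz_decay 2.
(* 12 = 2 * 3 * 2: the factor of [normr_diff2_le], the inequality 1 + x^2 <= 3 (1 + y^2) for |x - y|
   <= 1, and 1 <= 2 [pker 1 t] for |t| <= 1. *)
exists (12 * C); first by rewrite mulr_ge0.
move=> x t.
have q0 : 0 <= 2 * (2 * `|phi x| + `|phi (x + t)| + `|phi (x - t)|).
  by rewrite mulr_ge0// !addr_ge0// mulr_ge0.
have p1 (y : R) : 0 <= pker 1 y by exact: pker_ge0.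
have q1 : 0 <= 12 * C * pker 1 x by rewrite mulr_ge0// mulr_ge0.
have [->|t0] := eqVneq t 0.
  by rewrite diff20 mul0r normr0 mulr_ge0// addr_ge0.
have t2 : 0 < t ^+ 2 by rewrite exprn_even_gt0.
rewrite normrM normfV (gtr0_norm t2) ler_pdivrMr//.
have [t1|t1] := leP `|t| 1.
- have tt1 : t ^+ 2 <= 1 by rewrite -real_normK ?num_real// expr_le1.
  apply: (@le_trans _ _ (2 * t ^+ 2 * (3 * C * pker 1 x))).
    apply: normr_diff2_le; [exact: (sphi.1 0)|exact: (sphi.1 1)|].
    move=> y yx; apply: le_trans (hC y) _.
    rewrite [leRHS](_ : _ = C * (3 * pker 1 x)); last by ring.
    apply: ler_wpM2l => //.
    rewrite /pker expr1n !mul1r -[leRHS]invf_div invf_ple ?posrE ?invrK; last 2 first.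
    - by rewrite ltr_wpDl ?sqr_ge0.
    - by rewrite invr_gt0 divr_gt0// ltr_wpDl ?sqr_ge0.
    rewrite ler_pdivrMr//.
    have := le_trans yx t1; rewrite ler_norml => /andP[a1 a2].
    by have := sqr_ge0 y; have := sqr_ge0 (2 * y - x); nra.
  rewrite (_ : 2 * t ^+ 2 * (3 * C * pker 1 x) = 6 * C * pker 1 x * t ^+ 2); last by ring.
  apply: ler_wpM2r; first exact: ltW.
  apply: (@le_trans _ _ (12 * C * pker 1 x * pker 1 t)); last first.
    by apply: ler_wpM2r => //; rewrite lerDl.
  have -> : 6 * C * pker 1 x = 12 * C * pker 1 x * 2^-1 by field.
  apply: ler_wpM2l => //.
  rewrite /pker expr1n mul1r lef_pV2 ?posrE ?ltr_wpDl ?sqr_ge0//.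
  by rewrite -[2]/(1 + 1) lerD2r.
- have tt1 : 1 <= t ^+ 2 by rewrite -real_normK ?num_real// exprn_ege1// ltW.
  apply: le_trans (normr_diff2 _ _ _) _.
  set q := _ + `|phi (x - t)|; rewrite -/q in q0.
  apply: (@le_trans _ _ (2 * q * (pker 1 t * t ^+ 2))); last first.
    rewrite [leRHS](_ : _ =
      (12 * C * pker 1 x + 2 * q) * (pker 1 t * t ^+ 2)); last by rewrite mulrA.
    apply: ler_wpM2r; first by rewrite mulr_ge0// ltW.
    by rewrite lerDr.
  rewrite {1}(_ : q = 2 * q * 2^-1); last by field.
  apply: ler_wpM2l => //.
  rewrite /pker expr1n mul1r mulrC ler_pdivlMr; last by rewrite ltr_wpDl ?sqr_ge0.
  by lra.
Qed.

Lemma schwartz_diff2 : exists2 C : R, 0 <= C &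
  (forall x t, `|diff2 phi x t / t ^+ 2| <= C * pker 1 t) /\
  (forall t, \int[mu]_x `|diff2 phi x t / t ^+ 2| <= C * pker 1 t).
Proof.
have [C C0 hC] := schwartz_diff2_le.
have [B B0 hB] := schwartz_decay 0.
have p1 (y : R) : 0 <= pker 1 y by exact: pker_ge0.
have I1 := Int_pker1 R.
have pi0 := pi_ge0 R.
have Bx x : `|phi x| <= B.
  by apply: le_trans (hB x) _; rewrite ler_piMr// pker1_le1.
(* C + 8 B suffices for the uniform bound and (C + 8 B) pi for the integral over x; the factor 1 +
   pi covers both. *)
exists ((C + 8 * B) * (1 + pi)); first by apply: mulr_ge0; lra.
split=> [x t|t].
  apply: le_trans (hC x t) _; apply: ler_wpM2r => //.
  have := Bx x; have := Bx (x + t); have := Bx (x - t).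
  have : C * pker 1 x <= C by rewrite ler_piMr// pker1_le1.
  have : 0 <= C * pi by rewrite mulr_ge0.
  have : 0 <= B * pi by rewrite mulr_ge0.
  lra.
have aL := L1_norm schwartz_L1.
have La := L1_translate t aL; have Lb := L1_translate (- t) aL.
have LC := L1Zl C I1.1; have L2 := L1Zl 2 aL.
pose G x := pker 1 t * (C * pker 1 x + 2 * (2 * `|phi x| + `|phi (x + t)| + `|phi (x - t)|)).
have hG x : `|diff2 phi x t / t ^+ 2| <= G x by rewrite /G [leRHS]mulrC.
have LG : L1 G by apply: L1Zl; apply: L1D => //; apply: L1Zl; apply: L1D => //; apply: L1D.
have mD : measurable_fun setT (fun x => diff2 phi x t / t ^+ 2).
  apply: measurable_funM => //.
  exact: measurable_diff2l schwartz_measurable.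
apply: (@le_trans _ _ (\int[mu]_x G x)).
  apply: le_Int => //.
  apply: (@le_L1 _ _ G) => //; first exact: measurableT_comp.
  by move=> x; rewrite normr_id.
rewrite IntZl; last by apply: L1D => //; apply: L1Zl; apply: L1D => //; apply: L1D.
rewrite mulrC; apply: ler_wpM2r => //.
rewrite IntD//; last by apply: L1Zl; apply: L1D => //; apply: L1D.
rewrite IntZl ?I1.2; last exact: I1.1.
rewrite IntZl; last by apply: L1D => //; apply: L1D.
rewrite IntD//; last by apply: L1D.
rewrite IntD// IntZl// (Int_translate _ aL) (Int_translate _ aL).
have : \int[mu]_x `|phi x| <= B * pi.
  rewrite -I1.2 -IntZl; last exact: I1.1.
  by apply: le_Int => //; exact: L1Zl I1.1.
by lra.
Qed.

End SchwartzDecay.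

(** * The half-Laplacian as an absolutely convergent integral *)

Section HalfLaplacianFormula.
Variable R : realType.
Notation mu := (@lebesgue_measure R).
Variable phi : R -> R.
Hypothesis sphi : schwartz phi.

Let mphi := schwartz_measurable sphi.

Lemma measurable_sqrV : measurable_fun setT (fun t : R => (t ^+ 2)^-1).
Proof.
by apply: (measurableT_comp (@measurable_inv R)); exact: exprn_measurable.
Qed.

Lemma L1_diff2l t : L1 (fun x => diff2 phi x t).
Proof.
have pL := schwartz_L1 sphi.
apply: L1B; last exact: L1_translate.
by apply: L1B; [exact: L1Zl|exact: L1_translate].
Qed.

Lemma L1_diff2r x : L1 (fun t => diff2 phi x t / t ^+ 2).
Proof.
have [C C0 [hC _]] := schwartz_diff2 sphi.
apply: (@le_L1 _ _ (fun t => C * pker 1 t)); last exact: L1Zl (Int_pker1 _).1.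
  apply: measurable_funM; last exact: measurable_sqrV.
  exact: measurable_diff2r.
exact: hC.
Qed.

(** Substitute t = x - y and average with the reflection t -> - t. The truncation makes each of the
    two halves integrable separately. *)
Lemma truncated_half_laplacian x eps : 0 < eps ->
  \int[mu]_(y in [set y | eps < `|x - y|]) ((phi x - phi y) / `|x - y| ^+ 2) =
  2^-1 * \int[mu]_t ((if eps < `|t| then 1 else 0) * (diff2 phi x t / t ^+ 2)).
Proof.
move=> e0.
pose i (t : R) : R := if eps < `|t| then 1 else 0.
have mi : measurable_fun setT i.
  apply: measurable_fun_ifT => //.
  by apply: measurable_fun_ltr => //; exact: normr_measurable.
have i1 t : `|i t| <= 1 by rewrite /i; case: ifP; rewrite ?normr1 ?normr0.
pose G t := i t * ((phi x - phi (x - t)) / t ^+ 2).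
have [B B0 hB] := schwartz_decay sphi 0.
have Bx z : `|phi z| <= B.
  by apply: le_trans (hB z) _; rewrite ler_piMr// pker1_le1.
(* For |t| > eps one has 1 / t^2 <= (1 + eps^-2) [pker 1 t]. *)
have q0 : 0 <= 2 * B * (1 + eps ^- 2).
  by rewrite mulr_ge0 ?mulr_ge0// addr_ge0// invr_ge0 sqr_ge0.
have LG : L1 G.
  apply: (@le_L1 _ _ (fun t => 2 * B * (1 + eps ^- 2) * pker 1 t));
    last exact: L1Zl (Int_pker1 _).1.
    apply: measurable_funM => //; apply: measurable_funM; last exact: measurable_sqrV.
    by apply: measurable_funB => //; apply: (measurableT_comp mphi); exact: measurable_funB.
  move=> t; rewrite /G /i; case: ifPn => [et|_]; last first.
    by rewrite mul0r normr0 mulr_ge0// pker_ge0.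
  rewrite mul1r normrM -mulrA; apply: ler_pM => //.
    apply: le_trans (ler_normB _ _) _.
    by have := Bx x; have := Bx (x - t); lra.
  have t0 : 0 < `|t| by rewrite (lt_trans e0).
  rewrite normfV normrX /pker expr1n mul1r ler_pdivlMr; last by rewrite ltr_wpDl ?sqr_ge0.
  rewrite -(@real_normK _ t) ?num_real// mulrDr mulr1 mulVf ?gt_eqF ?exprn_gt0//.
  rewrite lerD2l lef_pV2 ?posrE ?exprn_gt0// ler_pXn2r ?nnegrE ?ltW//.
have LGN := L1_reflect 0 LG.
have -> : \int[mu]_(y in [set y | eps < `|x - y|]) ((phi x - phi y) / `|x - y| ^+ 2) =
    \int[mu]_y G (x - y).
  rewrite Rintegral_mkcond; apply: eq_Int => y.
  rewrite patchE /G /i subKr -(@real_normK _ (x - y)) ?num_real//.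
  case: ifPn; rewrite ?inE/= ?notin_setE/= => h; first by rewrite h mul1r.
  by rewrite ifF ?mul0r//; apply/negP.
rewrite (Int_reflect x LG).
have E : \int[mu]_t G t = \int[mu]_t G (0 - t) by rewrite (Int_reflect 0 LG).
have -> : \int[mu]_t (i t * (diff2 phi x t / t ^+ 2)) = \int[mu]_t (G t + G (0 - t)).
  apply: eq_Int => t; rewrite /G /i /diff2 !sub0r normrN sqrrN opprK.
  by case: ifP => _; ring.
by rewrite IntD// -E; field.
Qed.

(** After symmetrisation the integrand is absolutely integrable at 0, and the principal value is a
    limit by dominated convergence. *)
Lemma half_laplacianE x :
  half_laplacian phi x = (2 * pi)^-1 * \int[mu]_t (diff2 phi x t / t ^+ 2).
Proof.
rewrite /half_laplacian invfM mulrAC [RHS]mulrC; congr (_ * _).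
apply: cvg_lim => //; apply/cvg_at_rightP => u [u0 uc].
rewrite (funext (fun n => truncated_half_laplacian x (u0 n))).
apply: cvgM; first exact: cvg_cst.
have [C C0 [hC _]] := schwartz_diff2 sphi.
have [] // := @Int_cvg R (fun n t => (if u n < `|t| then 1 else 0) * (diff2 phi x t / t ^+ 2))
  (fun t => diff2 phi x t / t ^+ 2) (fun t => C * pker 1 t).
- move=> n; apply: measurable_funM.
    apply: measurable_fun_ifT => //.
    by apply: measurable_fun_ltr => //; exact: normr_measurable.
  exact: L1_measurable (L1_diff2r x).
- exact: L1_measurable (L1_diff2r x).
- apply: aeW => t; have [->|t0] := eqVneq t 0.
    by rewrite diff20 mul0r; under eq_fun do rewrite mulr0; exact: cvg_cst.
  apply/cvgrPdist_lt => e e0.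
  have t0' : 0 < `|t| by rewrite normr_gt0.
  apply: filterS (cvgr_lt _ uc _ t0') => n /= h.
  by rewrite h mul1r subrr normr0.
- exact: L1Zl (Int_pker1 _).1.
- apply: aeW => t n; apply: le_trans (hC x t).
  by case: ifP => _; rewrite ?mul1r// mul0r normr0.
Qed.

End HalfLaplacianFormula.

(** * Poisson integrals and the half-Laplacian *)

Section PoissonSemigroup.
Variable R : realType.
Notation mu := (@lebesgue_measure R).
Variables (U0 : R -> R) (U : R -> R -> R) (M : R).
Hypothesis mU0 : measurable_fun setT U0.
Hypothesis U0M : forall x, `|U0 x| <= M.
Hypothesis UE : forall e x, 0 < e -> \int[mu]_y (U0 y * pker e (y - x)) = pi * U e x.
Variable phi : R -> R.
Hypothesis sphi : schwartz phi.

Let mphi := schwartz_measurable sphi.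
Let pL := schwartz_L1 sphi.
Let M0 : 0 <= M.
Proof. exact: le_trans (U0M 0). Qed.

(** Both pairings to be compared are integrals of this function: [U0] with the half-Laplacian of
    [phi] against 1 / t^2, and U0 - U e with [phi] against [pker e]. *)
Let A t := \int[mu]_x (U0 x * diff2 phi x t).

Let A0 : A 0 = 0.
Proof.
rewrite /A -[RHS](mul0r (\int[mu]_x phi x)) -IntZl//.
by apply: eq_Int => x; rewrite diff20 mulr0 mul0r.
Qed.

Let A_div t : \int[mu]_x (U0 x * (diff2 phi x t / t ^+ 2)) = A t / t ^+ 2.
Proof.
rewrite mulrC -IntZl; last exact: L1M_bounded mU0 U0M (L1_diff2l sphi t).
by apply: eq_Int => x; rewrite mulrA mulrC.
Qed.

Let A_bound : exists2 C : R, 0 <= C & (forall t, `|A t / t ^+ 2| <= C * pker 1 t) /\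
  L1 (fun t => A t / t ^+ 2) /\
  L1 (fun x => U0 x * \int[mu]_t (diff2 phi x t / t ^+ 2)) /\
  \int[mu]_x (U0 x * \int[mu]_t (diff2 phi x t / t ^+ 2)) = \int[mu]_t (A t / t ^+ 2).
Proof.
have [C C0 [hC1 hC2]] := schwartz_diff2 sphi.
exists (M * C); first exact: mulr_ge0.
pose F (z : R * R) := U0 z.1 * (diff2 phi z.1 z.2 / z.2 ^+ 2).
have mF : measurable_fun setT F.
  apply: measurable_funM; first exact: (measurableT_comp mU0).
  apply: measurable_funM; first exact: measurable_diff2.
  apply: (measurableT_comp (@measurable_sqrV R)); exact: measurable_snd.
have F1 t : L1 (fun x => F (x, t)).
  apply: L1M_bounded mU0 U0M _.
  apply: (@eq_L1 _ (fun x => t ^- 2 * diff2 phi x t)); first by move=> x; rewrite mulrC.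
  exact: L1Zl (L1_diff2l sphi t).
have F2 x : L1 (fun t => F (x, t)) by exact: (L1Zl (U0 x) (L1_diff2r sphi x)).
have Fh t : \int[mu]_x `|F (x, t)| <= M * C * pker 1 t.
  have Ld : L1 (fun x => diff2 phi x t / t ^+ 2).
    apply: (@eq_L1 _ (fun x => t ^- 2 * diff2 phi x t)); first by move=> x; rewrite mulrC.
    exact: L1Zl (L1_diff2l sphi t).
  apply: (@le_trans _ _ (\int[mu]_x (M * `|diff2 phi x t / t ^+ 2|))).
    apply: le_Int; [exact: L1_norm|exact/L1Zl/L1_norm|].
    by move=> x; rewrite /F normrM; apply: ler_wpM2r.
  by rewrite IntZl -?mulrA; [apply: ler_wpM2l|exact: L1_norm].
have hL : L1 (fun t => M * C * pker 1 t) by exact: L1Zl (Int_pker1 _).1.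
have [G1 G2 GE] := Int_fubini mF F1 F2 Fh hL.
split.
  move=> t; rewrite -A_div; apply: le_trans (Fh t).
  exact: le_normr_Rintegral measurableT (F1 t).
split; first by apply: eq_L1 G1 => t; exact: A_div.
have FE x : \int[mu]_t F (x, t) = U0 x * \int[mu]_t (diff2 phi x t / t ^+ 2).
  by rewrite -(IntZl _ (L1_diff2r sphi x)).
split; first exact: eq_L1 FE G2.
rewrite -(eq_Int FE).
by rewrite GE; apply: eq_Int => t; exact: A_div.
Qed.

Let Uphi t : L1 (fun x => U0 (x + t) * phi x).
Proof.
apply: (@L1M_bounded _ M (fun x => U0 (x + t))) => //.
by apply: (measurableT_comp mU0); exact: measurable_funD.
Qed.

Let Uphi_shift t : \int[mu]_x (U0 x * phi (x + t)) = \int[mu]_x (U0 (x - t) * phi x).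
Proof.
rewrite -(Int_translate t (Uphi (- t))).
by apply: eq_Int => x; rewrite addrK.
Qed.

(** The second difference is self-adjoint, so it can be moved from [phi] to [U0], whose Poisson
    integrals are known. *)
Let A_dual t : A t = \int[mu]_x (phi x * diff2 U0 x t).
Proof.
have Lp s : L1 (fun x => U0 x * phi (x + s)).
  by apply: L1M_bounded mU0 U0M _; exact: L1_translate.
have L0 := L1M_bounded mU0 U0M pL.
transitivity (2 * \int[mu]_x (U0 x * phi x) - \int[mu]_x (U0 x * phi (x + t))
   - \int[mu]_x (U0 x * phi (x - t))).
  rewrite -IntZl// -IntB//; last exact: (L1Zl 2 L0).
  rewrite -IntB//; last by apply: L1B => //; exact: (L1Zl 2 L0).
  by apply: eq_Int => x; rewrite /diff2; ring.
rewrite !Uphi_shift opprK -IntZl// -IntB//; last exact: (L1Zl 2 L0).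
rewrite -IntB//; last by apply: L1B => //; exact: (L1Zl 2 L0).
by apply: eq_Int => x; rewrite /diff2; ring.
Qed.

Let U0_pker e x : 0 < e ->
  \int[mu]_t (diff2 U0 x t * pker e t) = 2 * pi * (U0 x - U e x).
Proof.
move=> e0.
have Lp := L1_pker e0.
have Lq : L1 (fun y => U0 y * pker e (y - x)).
  by apply: L1M_bounded mU0 U0M _; exact: L1_translate.
have L1' : L1 (fun t => U0 (x + t) * pker e t).
  apply: (@eq_L1 _ (fun t => U0 (t + x) * pker e (t + x - x))).
    by move=> t; rewrite addrK addrC.
  exact: (L1_translate x Lq).
have E1 : \int[mu]_t (U0 (x + t) * pker e t) = pi * U e x.
  rewrite -UE// -(Int_translate x Lq).
  by apply: eq_Int => t; rewrite addrK addrC.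
have L2' : L1 (fun t => U0 (x - t) * pker e t).
  apply: (@eq_L1 _ (fun t => U0 (x - t) * pker e (x - t - x))).
    by move=> t; rewrite addrAC subrr sub0r pkerN.
  exact: (L1_reflect x Lq).
have E2 : \int[mu]_t (U0 (x - t) * pker e t) = pi * U e x.
  rewrite -UE// -(Int_reflect x Lq).
  by apply: eq_Int => t; rewrite addrAC subrr sub0r pkerN.
transitivity (2 * U0 x * pi - pi * U e x - pi * U e x); last by ring.
rewrite -{1}E1 -E2 -(Int_pker e0) -IntZl// -IntB//; last exact: (L1Zl _ Lp).
rewrite -IntB//; last by apply: L1B => //; exact: (L1Zl _ Lp).
by apply: eq_Int => t; rewrite /diff2; ring.
Qed.

(** Fubini after [A_dual], with 4 M as a bound for the second differences of [U0]. It also supplies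
    the integrability of [phi x * (U0 x - U e x)], from which its measurability is taken later. *)
Let A_pker e : 0 < e -> \int[mu]_t (A t * pker e t) =
  2 * pi * \int[mu]_x (phi x * (U0 x - U e x)) /\
  L1 (fun x => phi x * (U0 x - U e x)) /\ L1 (fun t => A t * pker e t).
Proof.
move=> e0.
have d4 x t : `|diff2 U0 x t| <= 4 * M.
  apply: le_trans (normr_diff2 _ _ _) _.
  by have := U0M x; have := U0M (x + t); have := U0M (x - t); lra.
have Lp := L1_pker e0.
have pi2 : (2 * pi : R) != 0 by rewrite mulf_neq0// gt_eqF// pi_gt0.
pose F (z : R * R) := phi z.1 * diff2 U0 z.1 z.2 * pker e z.2.
have mF : measurable_fun setT F.
  apply: measurable_funM; last first.
    apply: (measurableT_comp (measurable_pker (lt0r_neq0 e0))); exact: measurable_snd.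
  apply: measurable_funM; first exact: (measurableT_comp mphi).
  exact: measurable_diff2.
have F1 t : L1 (fun x => F (x, t)).
  apply: (@eq_L1 _ (fun x => diff2 U0 x t * (pker e t * phi x))).
    by move=> x; rewrite /F /=; ring.
  by apply: L1M_bounded (measurable_diff2l t mU0) (d4^~ t) _; exact: (L1Zl _ pL).
have F2' x : L1 (fun t => diff2 U0 x t * pker e t).
  exact: L1M_bounded (measurable_diff2r x mU0) (d4 x) Lp.
have F2 x : L1 (fun t => F (x, t)).
  apply: (@eq_L1 _ (fun t => phi x * (diff2 U0 x t * pker e t))).
    by move=> t; rewrite /F /=; ring.
  exact: (L1Zl _ (F2' x)).
have Fh t : \int[mu]_x `|F (x, t)| <= (4 * M * \int[mu]_x `|phi x|) * pker e t.
  rewrite mulrAC -IntZl; last exact: L1_norm.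
  apply: le_Int; [exact: L1_norm|exact/L1Zl/L1_norm|].
  move=> x; rewrite /F /= normrM (ger0_norm (pker_ge0 t e0)) normrM.
  rewrite [leLHS](_ : _ = `|diff2 U0 x t| * (pker e t * `|phi x|)); last by ring.
  rewrite [leRHS](_ : _ = 4 * M * (pker e t * `|phi x|)); last by ring.
  apply: ler_wpM2r; last exact: d4.
  by apply: mulr_ge0 => //; exact: pker_ge0.
have hL : L1 (fun t => (4 * M * \int[mu]_x `|phi x|) * pker e t) by exact: (L1Zl _ Lp).
have [G1 G2 GE] := Int_fubini mF F1 F2 Fh hL.
have FE x : \int[mu]_t F (x, t) = 2 * pi * (phi x * (U0 x - U e x)).
  rewrite mulrCA -(U0_pker x e0) -(IntZl _ (F2' x)).
  by apply: eq_Int => t; rewrite /F /=; ring.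
have LU : L1 (fun x => phi x * (U0 x - U e x)).
  apply: (@eq_L1 _ (fun x => (2 * pi)^-1 * \int[mu]_t F (x, t))).
    by move=> x; rewrite FE mulKf.
  exact: (L1Zl _ G2).
have FA t : \int[mu]_x F (x, t) = A t * pker e t.
  rewrite A_dual mulrC -IntZl.
    by apply: eq_Int => x; rewrite /F /=; ring.
  apply: (@eq_L1 _ (fun x => diff2 U0 x t * phi x)); first by move=> x; rewrite mulrC.
  exact: L1M_bounded (measurable_diff2l t mU0) (d4^~ t) pL.
split; last by split; [exact: LU|exact: eq_L1 FA G1].
rewrite -(IntZl _ LU) -(eq_Int FE) GE.
by apply: eq_Int => t; rewrite FA.
Qed.

Variables (f g : R -> R).
Hypothesis mf : measurable_fun setT f.
Hypothesis U0U : {ae mu, forall x, forall e, 0 < e -> `|U0 x - U e x| <= e * g x}.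
Hypothesis Uf : {ae mu, forall x,
  ((U0 x - U (harmonic n) x) / harmonic n) @[n --> \oo] --> f x}.
Hypothesis gphi : L1 (fun x => g x * phi x).

(** One sequence, two limits: by [A_pker], the integral of [A] against the regularised kernel is, up
    to 2 pi, the integral of [phi] against the difference quotient of [U] in the height. The first
    form is dominated by [A_bound], the second by [g]. *)
Lemma poisson_half_laplacian : L1 (fun x => f x * phi x) /\
  half_laplacian_dist U0 phi = \int[mu]_x (f x * phi x).
Proof.
have [C C0 [hC [LA [LU UA]]]] := A_bound.
have pi0 : (pi : R) != 0 by rewrite gt_eqF// pi_gt0.
pose e n : R := harmonic n.
have e0 n : 0 < e n by exact: harmonic_gt0.
have ec : e n @[n --> \oo] --> (0 : R) by exact: cvg_harmonic.
(* Measurability of [A] is recovered from the quotient treated by Fubini; at t = 0 the default value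
   of the quotient is consistent with A 0 = 0. *)
have mA : measurable_fun setT A.
  have -> : A = fun t => t ^+ 2 * (A t / t ^+ 2).
    apply/funext => t; have [->|t0] := eqVneq t 0; first by rewrite A0 mul0r mulr0.
    by rewrite mulrC divfK// expf_neq0.
  by apply: measurable_funM; [exact: exprn_measurable|exact: L1_measurable].
have EK n t : (e n)^-1 * pker (e n) t = (t ^+ 2 + e n ^+ 2)^-1.
  by rewrite /pker mulrA mulVf ?mul1r// lt0r_neq0.
have lim1 : \int[mu]_t (A t * ((e n)^-1 * pker (e n) t)) @[n --> \oo] -->
    \int[mu]_t (A t / t ^+ 2).
  have [] // := @Int_cvg R (fun n t => A t * ((e n)^-1 * pker (e n) t))
    (fun t => A t / t ^+ 2) (fun t => C * pker 1 t).
  - move=> n; apply: measurable_funM => //; apply: measurable_funM => //.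
    by apply: measurable_pker; exact: lt0r_neq0.
  - exact: L1_measurable.
  - apply: aeW => t; have [->|t0] := eqVneq t 0.
      by rewrite A0 mul0r; under eq_fun do rewrite mul0r; exact: cvg_cst.
    apply: cvgM; first exact: cvg_cst.
    rewrite (funext (EK^~ t)); apply: cvgV; first by rewrite expf_neq0.
    rewrite -[X in _ --> X]addr0; apply: cvgD; first exact: cvg_cst.
    rewrite (_ : 0 = (0 : R) ^+ 2); last by rewrite expr0n.
    exact: (cvg_comp _ _ ec (@exprn_continuous _ 2 _)).
  - exact: (L1Zl C (Int_pker1 R).1).
  - apply: aeW => t n; apply: le_trans (hC t).
    have [->|t0] := eqVneq t 0; first by rewrite A0 !mul0r.
    rewrite EK !normrM; apply: ler_wpM2l => //.
    rewrite !ger0_norm ?invr_ge0 ?addr_ge0 ?sqr_ge0//.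
    rewrite lef_pV2 ?posrE; last 2 first.
    - by rewrite ltr_pwDr ?exprn_gt0 ?sqr_ge0.
    - by rewrite exprn_even_gt0.
    by rewrite lerDl sqr_ge0.
have [Lf lim2] : L1 (fun x => f x * phi x) /\
    \int[mu]_x ((e n)^-1 * (phi x * (U0 x - U (e n) x))) @[n --> \oo] -->
    \int[mu]_x (f x * phi x).
  apply: (@Int_cvg R _ _ (fun x => `|g x * phi x|)).
  - by move=> n; apply: measurable_funM => //; exact: L1_measurable (A_pker (e0 n)).2.1.
  - exact: measurable_funM.
  - apply: aeS Uf => x h; rewrite mulrC.
    rewrite (_ : (fun n => _) = (fun n => phi x * ((U0 x - U (e n) x) / e n))).
      by apply: cvgM; [exact: cvg_cst|exact: h].
    by apply/funext => n; ring.
  - exact: L1_norm.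
  - apply: aeS U0U => x h n.
    rewrite !normrM normfV (gtr0_norm (e0 n)) mulrCA mulrC; apply: ler_wpM2r => //.
    rewrite ler_pdivrMl//; apply: le_trans (h _ (e0 n)) _.
    by apply: ler_wpM2l; [exact: ltW|exact: ler_norm].
split => //.
rewrite /half_laplacian_dist.
transitivity ((2 * pi)^-1 * \int[mu]_t (A t / t ^+ 2)).
  rewrite -UA -IntZl//.
  by apply: eq_Int => x; rewrite half_laplacianE// mulrCA.
have E n : (2 * pi)^-1 * \int[mu]_t (A t * ((e n)^-1 * pker (e n) t)) =
    \int[mu]_x ((e n)^-1 * (phi x * (U0 x - U (e n) x))).
  rewrite IntZl; last exact: (A_pker (e0 n)).2.1.
  transitivity ((2 * pi)^-1 * ((e n)^-1 * \int[mu]_t (A t * pker (e n) t))).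
    congr (_ * _); rewrite -IntZl; last exact: (A_pker (e0 n)).2.2.
    by apply: eq_Int => t; rewrite mulrCA.
  by rewrite (A_pker (e0 n)).1 mulrCA mulKf// mulf_neq0.
have lim3 : (2 * pi)^-1 * \int[mu]_t (A t * ((e n)^-1 * pker (e n) t)) @[n --> \oo] -->
    (2 * pi)^-1 * \int[mu]_t (A t / t ^+ 2).
  by apply: cvgM; [exact: cvg_cst|exact: lim1].
move: lim3; rewrite (funext E) => lim3.
exact: (cvg_unique _ lim3 lim2).
Qed.

End PoissonSemigroup.

(** * The inverse Joukowski map *)

Section ComplexNorm.
Variable R : realType.
Implicit Types z w : R[i].
Notation Re := complex.Re.
Notation Im := complex.Im.
Notation normc := (@ComplexField.Normc.normc R).

Lemma normc_sqr z : normc z ^+ 2 = Re z ^+ 2 + Im z ^+ 2.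
Proof. by case: z => a b /=; rewrite sqr_sqrtr ?addr_ge0 ?sqr_ge0. Qed.

Lemma normc_ge0 z : 0 <= normc z.
Proof. by case: z => a b /=; exact: sqrtr_ge0. Qed.

Lemma normr_Re_le z : `|Re z| <= normc z.
Proof.
case: z => a b /=; rewrite -sqrtr_sqr ler_wsqrtr// lerDl; exact: sqr_ge0.
Qed.

Lemma normr_Im_le z : `|Im z| <= normc z.
Proof.
case: z => a b /=; rewrite -sqrtr_sqr ler_wsqrtr// lerDr; exact: sqr_ge0.
Qed.

Lemma normcX z n : normc (z ^+ n) = normc z ^+ n.
Proof.
elim: n => [|n IH]; first by rewrite !expr0 ComplexField.Normc.normc1.
by rewrite !exprS ComplexField.Normc.normcM IH.
Qed.

Lemma cReB z w : Re (z - w) = Re z - Re w. Proof. by case: z; case: w. Qed.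
Lemma cImB z w : Im (z - w) = Im z - Im w. Proof. by case: z; case: w. Qed.
Lemma cReD z w : Re (z + w) = Re z + Re w. Proof. by case: z; case: w. Qed.
Lemma cImD z w : Im (z + w) = Im z + Im w. Proof. by case: z; case: w. Qed.
Lemma cReM z w : Re (z * w) = Re z * Re w - Im z * Im w.
Proof. by case: z; case: w. Qed.
Lemma cImM z w : Im (z * w) = Re z * Im w + Im z * Re w.
Proof. by case: z; case: w. Qed.
End ComplexNorm.

Section Joukowski.
Variable R : realType.
Notation Re := complex.Re.
Notation Im := complex.Im.
Notation normc := (@ComplexField.Normc.normc R).
Notation normcM := ComplexField.Normc.normcM.
Implicit Types x s e : R.

(* jsqrt x s is the square root of (x + i s)^2 - 1 lying in the same quadrant
   as x + i s, given by the half-angle formulas. *)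
Definition jnorm x s : R :=
  Num.sqrt ((x ^+ 2 - s ^+ 2 - 1) ^+ 2 + (2 * x * s) ^+ 2).
Definition jsqrt x s : R[i] :=
  Complex (Num.sg x * Num.sqrt ((jnorm x s + (x ^+ 2 - s ^+ 2 - 1)) / 2))
          (Num.sqrt ((jnorm x s - (x ^+ 2 - s ^+ 2 - 1)) / 2)).
Definition jouk x s : R[i] := Complex x s - jsqrt x s.

Lemma jnorm_ge x s : `|x ^+ 2 - s ^+ 2 - 1| <= jnorm x s.
Proof. by rewrite -sqrtr_sqr ler_wsqrtr// lerDl sqr_ge0. Qed.

Lemma jsqrt_sqr x s : 0 <= s -> jsqrt x s ^+ 2 = Complex x s ^+ 2 - 1.
Proof.
move=> s0; rewrite /jsqrt; set a := x ^+ 2 - s ^+ 2 - 1; set r := jnorm x s.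
have := jnorm_ge x s; rewrite -/a -/r ler_norml => /andP[ra1 ra2].
have p0 : 0 <= (r + a) / 2 by rewrite divr_ge0//; lra.
have m0 : 0 <= (r - a) / 2 by rewrite divr_ge0//; lra.
have r2 : r ^+ 2 = a ^+ 2 + (2 * x * s) ^+ 2.
  by rewrite sqr_sqrtr// addr_ge0// sqr_ge0.
have pm : Num.sqrt ((r + a) / 2) * Num.sqrt ((r - a) / 2) = `|x| * s.
  rewrite -sqrtrM// -[s in RHS]ger0_norm// -normrM -sqrtr_sqr; congr Num.sqrt.
  have -> : (r + a) / 2 * ((r - a) / 2) = (r ^+ 2 - a ^+ 2) / 4 by field.
  by rewrite r2; field.
(* At x = 0 the sign factor is 0, but there r = - a and the quantity it multiplies already
   vanishes. *)
have sg2 : Num.sg x ^+ 2 * ((r + a) / 2) = (r + a) / 2.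
  have [x0|x0] := eqVneq x 0; last by rewrite sqr_sg x0 mul1r.
  have ra : r = - a.
    have a0 : a <= 0 by rewrite /a x0 expr0n /=; have := sqr_ge0 s; lra.
    by rewrite /r /jnorm -/a x0 mulr0 mul0r expr0n /= addr0 sqrtr_sqr ler0_norm.
  by rewrite ra addNr mul0r mulr0.
have e1 : (Num.sg x * Num.sqrt ((r + a) / 2)) ^+ 2 - Num.sqrt ((r - a) / 2) ^+ 2 = a.
  by rewrite exprMn !sqr_sqrtr// sg2; field.
have e2 : 2 * (Num.sg x * Num.sqrt ((r + a) / 2) * Num.sqrt ((r - a) / 2)) = 2 * x * s.
  by rewrite -mulrA pm (mulrA (Num.sg x)) -numEsg; ring.
apply/eqP; rewrite eq_complex !expr2 cReB cImB !cReM !cImM /=; apply/andP; split; apply/eqP.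
  by rewrite -!expr2 e1 /a; ring.
by move: e2 => /= e2; lra.
Qed.

Lemma jsqrt_Im_ge0 x s : 0 <= Im (jsqrt x s).
Proof. exact: sqrtr_ge0. Qed.

Lemma jsqrt_Re x s : 0 <= Num.sg x * Re (jsqrt x s).
Proof. by rewrite /= mulrA -expr2 mulr_ge0 ?sqr_ge0 ?sqrtr_ge0. Qed.

Lemma jsqrt_Re_ge0 x s : 0 <= x * Re (jsqrt x s).
Proof. by rewrite {1}[x]numEsg mulrAC mulr_ge0// jsqrt_Re. Qed.

Lemma jouk_mul x s : 0 <= s -> jouk x s * (Complex x s + jsqrt x s) = 1.
Proof.
move=> s0; rewrite /jouk -subr_sqr jsqrt_sqr//; ring.
Qed.

(** Polarisation: |z + S|^2 - |z - S|^2 is four times the inner product of z and S, which is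
    nonnegative because they share a quadrant. *)
Lemma jouk_conj_norm x s : 0 <= s ->
  normc (jouk x s) ^+ 2 + 4 * (x * Re (jsqrt x s) + s * Im (jsqrt x s)) =
  normc (Complex x s + jsqrt x s) ^+ 2.
Proof.
by move=> s0; rewrite /jouk !normc_sqr cReB cImB cReD cImD; case: (jsqrt x s) => a b /=; ring.
Qed.

(** The moduli of z - S and z + S have product 1, and by [jouk_conj_norm] the former is the
    smaller. *)
Lemma jouk_norm_le1 x s : 0 <= s -> normc (jouk x s) <= 1.
Proof.
move=> s0.
have := jouk_mul x s0 => /(congr1 normc); rewrite normcM ComplexField.Normc.normc1 => h.
have := jouk_conj_norm x s0.
have := jsqrt_Re_ge0 x s; have := mulr_ge0 s0 (jsqrt_Im_ge0 x s).
have := normc_ge0 (jouk x s); have := normc_ge0 (Complex x s + jsqrt x s).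
move: h; set w := normc (jouk x s); set v := normc (_ + _).
set A := x * _; set B := s * _ => h v0 w0 B0 A0 e.
have wv : w <= v by rewrite -ler_sqr ?nnegrE//; lra.
by rewrite leNgt; apply/negP => w1; nra.
Qed.

Lemma jouk_norm_lt1 x s : 0 < s -> normc (jouk x s) < 1.
Proof.
move=> s0; have s0' := ltW s0.
have := jouk_mul x s0' => /(congr1 normc); rewrite normcM ComplexField.Normc.normc1 => h.
have := jouk_conj_norm x s0'.
have := jsqrt_Re_ge0 x s.
(* Were the imaginary part 0, the square z^2 - 1 would be real and nonnegative; being real forces x
   = 0, and then it equals - s^2 - 1. *)
have : 0 < s * Im (jsqrt x s).
  rewrite mulr_gt0// lt_neqAle jsqrt_Im_ge0 andbT eq_sym; apply/eqP => t0.
  have := jsqrt_sqr x s0'; move: t0; case: (jsqrt x s) => a b /= ->.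
  move=> /eqP; rewrite eq_complex !expr2 cReB cImB !cReM !cImM /= => /andP[/eqP h1 /eqP h2].
  have xs : x * s = 0 by lra.
  have x0 : x = 0 by apply/eqP; move/eqP: xs; rewrite mulf_eq0 (gt_eqF s0) orbF.
  by move: h1; rewrite x0; nra.
have := normc_ge0 (jouk x s); have := normc_ge0 (Complex x s + jsqrt x s).
move: h; set w := normc (jouk x s); set v := normc (_ + _).
set A := x * _; set B := s * _ => h v0 w0 B0 A0 e.
have wv : w < v by rewrite -ltr_sqr ?nnegrE//; lra.
by rewrite ltNge; apply/negP => w1; nra.
Qed.

Lemma jouk_rec x s : 0 <= s -> jouk x s ^+ 2 = 2%:R * Complex x s * jouk x s - 1.
Proof.
by move=> s0; rewrite -[X in _ - X](jouk_mul x s0) /jouk; ring.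
Qed.

(** Both roots lie in the same closed quadrant, so nothing cancels in their sum. *)
Lemma jsqrt_add_norm x e : 0 <= e ->
  normc (jsqrt x 0) <= normc (jsqrt x e + jsqrt x 0).
Proof.
move=> e0; rewrite -ler_sqr ?nnegrE ?normc_ge0// !normc_sqr cReD cImD.
have h : 0 <= Re (jsqrt x e) * Re (jsqrt x 0).
  rewrite /= mulrACA -expr2 mulr_ge0 ?sqr_ge0// mulr_ge0 ?sqrtr_ge0//.
have h2 := mulr_ge0 (jsqrt_Im_ge0 x e) (jsqrt_Im_ge0 x 0).
have := sqr_ge0 (Re (jsqrt x e)); have := sqr_ge0 (Im (jsqrt x e)).
by lra.
Qed.

(** Multiplying by the sum of the roots turns their difference into z_e^2 - z_0^2. By
    [jsqrt_add_norm] that sum is bounded below uniformly in e. *)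
Lemma jouk_diff x e : 0 <= e ->
  (jouk x e - jouk x 0) * (jsqrt x e + jsqrt x 0) =
  - (Complex 0 e * (jouk x e + jouk x 0)).
Proof.
move=> e0.
have h1 := jsqrt_sqr x e0; have h2 := jsqrt_sqr x (lexx (0 : R)).
have zE : Complex x e = Complex x 0 + Complex 0 e :> R[i].
  by apply/eqP; rewrite eq_complex cReD cImD /= addr0 add0r !eqxx.
have -> : (jouk x e - jouk x 0) * (jsqrt x e + jsqrt x 0) =
  Complex 0 e * (jsqrt x e + jsqrt x 0) - (jsqrt x e ^+ 2 - jsqrt x 0 ^+ 2).
  by rewrite /jouk zE; ring.
by rewrite h1 h2 /jouk zE; ring.
Qed.

End Joukowski.

(** * First-order expansion in the height of powers of w *)

Section JoukowskiDerivative.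
Variable R : realType.
Notation Re := complex.Re.
Notation Im := complex.Im.
Notation normc := (@ComplexField.Normc.normc R).
Notation normcM := ComplexField.Normc.normcM.
Implicit Types x s e : R.

Lemma normcD_le (z w : R[i]) : normc (z + w) <= normc z + normc w.
Proof. exact: le_normcD. Qed.

Lemma normcB_le (z w : R[i]) : normc (z - w) <= normc z + normc w.
Proof. by rewrite -(normcN w); exact: le_normcD. Qed.

Lemma normc_nat n : normc n%:R = n%:R.
Proof. by rewrite normcMn ComplexField.Normc.normc1. Qed.

Lemma normc_imag e : 0 <= e -> normc (Complex 0 e) = e.
Proof. by move=> e0; rewrite /= expr0n add0r sqrtr_sqr ger0_norm. Qed.

Lemma normc_exp_le1 (w : R[i]) n : normc w <= 1 -> normc (w ^+ n) <= 1.
Proof. by move=> w1; rewrite normcX exprn_ile1// normc_ge0. Qed.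

Lemma normc_expB_le (w w0 : R[i]) n : normc w <= 1 -> normc w0 <= 1 ->
  normc (w ^+ n - w0 ^+ n) <= n%:R * normc (w - w0).
Proof.
move=> w1 w01; elim: n => [|n IH].
  by rewrite !expr0 subrr mul0r ComplexField.Normc.normc0.
rewrite (_ : _ - _ = w * (w ^+ n - w0 ^+ n) + w0 ^+ n * (w - w0)); last first.
  by rewrite !exprS; ring.
apply: le_trans (normcD_le _ _) _; rewrite -natr1 mulrDl mul1r !normcM; apply: lerD.
  by apply: le_trans IH; apply: ler_piMl => //; exact: normc_ge0.
by apply: ler_piMl; [exact: normc_ge0|exact: normc_exp_le1].
Qed.

(** The constant is crude but stable under the induction: (n + 1)^2 + (n + 1) <= (n + 2)^2. *)
Lemma normc_expB_taylor (w w0 : R[i]) n : normc w <= 1 -> normc w0 <= 1 ->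
  normc (w ^+ n.+1 - w0 ^+ n.+1 - n.+1%:R * w0 ^+ n * (w - w0)) <=
  n.+1%:R ^+ 2 * normc (w - w0) ^+ 2.
Proof.
move=> w1 w01; elim: n => [|n IH].
  rewrite !expr1 expr0 !mul1r subrr ComplexField.Normc.normc0 expr1n mul1r.
  exact: sqr_ge0.
rewrite (_ : _ - _ - _ = w * (w ^+ n.+1 - w0 ^+ n.+1 - n.+1%:R * w0 ^+ n * (w - w0))
   + n.+1%:R * w0 ^+ n * (w - w0) ^+ 2); last first.
  by rewrite -[n.+2%:R]natr1 !exprS; ring.
apply: le_trans (normcD_le _ _) _.
set d := normc (w - w0).
have d0 : 0 <= d ^+ 2 by exact: sqr_ge0.
apply: (@le_trans _ _ (n.+1%:R ^+ 2 * d ^+ 2 + n.+1%:R * d ^+ 2)).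
  apply: lerD.
    rewrite normcM; apply: le_trans IH; apply: ler_piMl => //; exact: normc_ge0.
  rewrite normcM normcX; apply: ler_wpM2r => //.
  by rewrite normcM normc_nat ler_piMr ?ler0n// normc_exp_le1.
rewrite -mulrDl; apply: ler_wpM2r => //.
by rewrite -[n.+2%:R]natr1; have := ler0n R n.+1; nra.
Qed.

(** This estimate is linear in e with a locally integrable coefficient in x, and is what dominates
    the difference quotients. *)
Lemma jouk_diff_norm x e : 0 <= e -> jsqrt x 0 != 0 ->
  normc (jouk x e - jouk x 0) <= 2 / normc (jsqrt x 0) * e.
Proof.
move=> e0 S0.
have n0 : 0 < normc (jsqrt x 0).
  rewrite lt_neqAle normc_ge0 andbT eq_sym; apply/eqP => /ComplexField.Normc.eq0_normc.
  by move/eqP; rewrite (negbTE S0).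
have := congr1 normc (jouk_diff x e0); rewrite normcM normcN normcM normc_imag// => h.
rewrite mulrAC ler_pdivlMr//.
apply: (@le_trans _ _ (normc (jouk x e - jouk x 0) * normc (jsqrt x e + jsqrt x 0))).
  by apply: ler_wpM2l; [exact: normc_ge0|exact: jsqrt_add_norm].
rewrite h mulrC; apply: ler_wpM2r => //.
apply: le_trans (normcD_le _ _) _.
by have := jouk_norm_le1 x e0; have := jouk_norm_le1 x (lexx (0 : R)); lra.
Qed.

(** The linear term comes from w' = - w / S. The constant may depend on x, since only pointwise
    convergence is drawn from it. *)
Lemma jouk_exp_taylor x n : jsqrt x 0 != 0 -> exists K : R, forall e, 0 <= e ->
  normc (jouk x e ^+ n.+1 - jouk x 0 ^+ n.+1 +
    Complex 0 e * (n.+1%:R * jouk x 0 ^+ n.+1 / jsqrt x 0)) <= K * e ^+ 2.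
Proof.
move=> S0; set c := 2 / normc (jsqrt x 0).
have n0 : 0 < normc (jsqrt x 0).
  rewrite lt_neqAle normc_ge0 andbT eq_sym; apply/eqP => /ComplexField.Normc.eq0_normc.
  by move/eqP; rewrite (negbTE S0).
exists (n.+1%:R ^+ 2 * c ^+ 2 + n.+1%:R * ((c ^+ 2 + 2 * c) / (2 * normc (jsqrt x 0)))) => e e0.
have w1 := jouk_norm_le1 x e0; have w01 := jouk_norm_le1 x (lexx (0 : R)).
have dc := jouk_diff_norm e0 S0; rewrite -/c in dc.
have T := normc_expB_taylor n w1 w01.
have E := jouk_diff x e0.
have SB : jsqrt x e - jsqrt x 0 = Complex 0 e - (jouk x e - jouk x 0).
  apply/eqP; rewrite eq_complex /jouk; case: (jsqrt x e) => a b; case: (jsqrt x 0) => a' b'.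
  by rewrite !cReB !cImB /=; apply/andP; split; apply/eqP; ring.
move: T dc E SB w01; move: (jouk x e) (jouk x 0) (jsqrt x e) (jsqrt x 0) S0 @c n0.
move=> w w0 S S0 Sn0 c n0 T dc E SB w01.
set J := Complex 0 e.
set d := w - w0; rewrite -/d -/J in T dc E SB.
have d0 : 0 <= normc d by exact: normc_ge0.
(* Write 2 S0 = (S + S0) - (S - S0), then use [jouk_diff] for the sum and S - S0 = J - d for the
   difference: the right side is visibly of second order. *)
have lin : (d + J * (w0 / S0)) * (2%:R * S0) = d ^+ 2 - 2%:R * J * d.
  have -> : (d + J * (w0 / S0)) * (2%:R * S0) = d * (S + S0) - d * (S - S0) + 2%:R * J * w0.
    by field.
  by rewrite E SB /d; ring.
have linn : normc (d + J * (w0 / S0)) <= (c ^+ 2 + 2 * c) / (2 * normc S0) * e ^+ 2.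
  rewrite mulrAC ler_pdivlMr ?mulr_gt0//.
  rewrite -{1}(normc_nat 2) -!normcM lin.
  apply: le_trans (normcB_le _ _) _.
  rewrite (normcX d 2) (normcM (2%:R * J)) (normcM 2%:R) normc_nat normc_imag//.
  have : normc d ^+ 2 <= (c * e) ^+ 2 by rewrite ler_sqr ?nnegrE// (le_trans d0).
  have : e * normc d <= e * (c * e) by exact: ler_wpM2l.
  by rewrite exprMn; nra.
rewrite (_ : _ + _ = (w ^+ n.+1 - w0 ^+ n.+1 - n.+1%:R * w0 ^+ n * d) +
  n.+1%:R * w0 ^+ n * (d + J * (w0 / S0))); last by rewrite !exprS; field.
apply: le_trans (normcD_le _ _) _; rewrite mulrDl; apply: lerD.
  apply: le_trans T _.
  rewrite [leRHS](_ : _ = n.+1%:R ^+ 2 * (c * e) ^+ 2); last by ring.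
  apply: ler_wpM2l; first exact: sqr_ge0.
  by rewrite ler_sqr ?nnegrE// (le_trans d0).
rewrite normcM -mulrA; apply: ler_pM; [exact: normc_ge0|exact: normc_ge0| |exact: linn].
by rewrite normcM normc_nat ler_piMr ?ler0n// normc_exp_le1.
Qed.

(** The derivative of w^(n+1) in the height is - i Q. The real part is differenced downwards and the
    imaginary part upwards because Ttilde is Re w^n and W is - Im w^(n+1). *)
Lemma cvg_jouk_exp x n (h : nat -> R) : jsqrt x 0 != 0 ->
  (forall m, 0 < h m) -> h m @[m --> \oo] --> (0 : R) ->
  let Q := n.+1%:R * jouk x 0 ^+ n.+1 / jsqrt x 0 in
  (Re (jouk x 0 ^+ n.+1) - Re (jouk x (h m) ^+ n.+1)) / h m
     @[m --> \oo] --> - Im Q /\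
  (Im (jouk x (h m) ^+ n.+1) - Im (jouk x 0 ^+ n.+1)) / h m
     @[m --> \oo] --> - Re Q.
Proof.
move=> S0 hp hc Q; have [K hK] := jouk_exp_taylor n S0.
have K' m : normc (jouk x (h m) ^+ n.+1 - jouk x 0 ^+ n.+1 +
    Complex 0 (h m) * Q) / h m <= `|K| * h m.
  rewrite ler_pdivrMr// -mulrA -expr2; apply: le_trans (hK _ (ltW (hp m))) _.
  by apply: ler_wpM2r; [exact: sqr_ge0|exact: ler_norm].
have K0 : `|K| * h m @[m --> \oo] --> (0 : R).
  by rewrite -[X in _ --> X](mulr0 `|K|); apply: cvgM; [exact: cvg_cst|exact: hc].
have sq (u : nat -> R) l : (forall m, `|u m - l| <= `|K| * h m) -> u m @[m --> \oo] --> l.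
  move=> ul; apply/cvgrPdist_le => e e0.
  apply: filterS (cvgr_lt _ K0 _ e0) => m he.
  by rewrite /= distrC; exact: ltW (le_lt_trans (ul m) he).
split; apply: sq => m; apply: le_trans (K' m).
  rewrite ler_pdivlMr// -[X in _ * X <= _](gtr0_norm (hp m)) -normrM mulrBl divfK ?gt_eqF//.
  apply: le_trans (normr_Re_le _); rewrite cReD cReB cReM /= mul0r sub0r -normrN.
  by rewrite le_eqVlt; apply/orP; left; apply/eqP; congr `|_|; ring.
rewrite ler_pdivlMr// -[X in _ * X <= _](gtr0_norm (hp m)) -normrM mulrBl divfK ?gt_eqF//.
apply: le_trans (normr_Im_le _); rewrite cImD cImB cImM /= mul0r add0r.
by rewrite le_eqVlt; apply/orP; left; apply/eqP; congr `|_|; ring.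
Qed.

End JoukowskiDerivative.

(** * The Chebyshev functions as boundary values of powers of w *)

Section ChebyshevJoukowski.
Variable R : realType.
Notation Re := complex.Re.
Notation Im := complex.Im.
Notation normc := (@ComplexField.Normc.normc R).
Implicit Types x s e : R.

Lemma jsqrt0_le1 x : `|x| <= 1 -> jsqrt x 0 = Complex 0 (Num.sqrt (1 - x ^+ 2)).
Proof.
move=> x1; have x2 : x ^+ 2 <= 1 by rewrite -real_normK ?num_real// expr_le1.
rewrite /jsqrt /jnorm mulr0 expr0n /= addr0 subr0 sqrtr_sqr ler0_norm; last by lra.
by rewrite addNr mul0r sqrtr0 mulr0; congr (Complex _ (Num.sqrt _)); field.
Qed.

Lemma jsqrt0_gt1 x : 1 < `|x| ->
  jsqrt x 0 = Complex (Num.sg x * Num.sqrt (x ^+ 2 - 1)) 0.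
Proof.
move=> x1; have x2 : 1 < x ^+ 2 by rewrite -real_normK ?num_real// exprn_egt1.
rewrite /jsqrt /jnorm mulr0 expr0n /= addr0 subr0 sqrtr_sqr gtr0_norm; last by lra.
by rewrite subrr mul0r sqrtr0; congr (Complex (_ * Num.sqrt _) _); field.
Qed.

Lemma jouk_exp_rec x n :
  jouk x 0 ^+ n.+2 = 2%:R * Complex x 0 * jouk x 0 ^+ n.+1 - jouk x 0 ^+ n.
Proof. by rewrite -addn2 exprD jouk_rec// exprS; ring. Qed.

(** For x = cos t with 0 <= t <= pi this is w = exp(- i t) and de Moivre's formula. Two consecutive
    powers are carried along because the recurrence has three terms. *)
Lemma jouk_exp_le1 x n : `|x| <= 1 ->
  jouk x 0 ^+ n.+1 =
  Complex (chebyshevT R n.+1).[x] (- (Num.sqrt (1 - x ^+ 2) * (chebyshevU R n).[x])).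
Proof.
move=> x1; suff : jouk x 0 ^+ n.+1 =
    Complex (chebyshevT R n.+1).[x] (- (Num.sqrt (1 - x ^+ 2) * (chebyshevU R n).[x]))
  /\ jouk x 0 ^+ n.+2 =
    Complex (chebyshevT R n.+2).[x] (- (Num.sqrt (1 - x ^+ 2) * (chebyshevU R n.+1).[x]))
  by case.
have E1 : jouk x 0 ^+ 1 = Complex (chebyshevT R 1).[x]
    (- (Num.sqrt (1 - x ^+ 2) * (chebyshevU R 0).[x])).
  rewrite expr1 /jouk jsqrt0_le1// /= !hornerE.
  by apply/eqP; rewrite eq_complex cReB cImB /= subr0 sub0r !eqxx.
have E0 : jouk x 0 ^+ 0 = Complex 1 0 by rewrite expr0.
have TS k : (chebyshevT R k.+2).[x] = 2 * x * (chebyshevT R k.+1).[x] - (chebyshevT R k).[x].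
  by rewrite [chebyshevT R k.+2]/(2%:P * 'X * chebyshevT R k.+1 - chebyshevT R k) !hornerE.
have US k : (chebyshevU R k.+2).[x] = 2 * x * (chebyshevU R k.+1).[x] - (chebyshevU R k).[x].
  by rewrite [chebyshevU R k.+2]/(2%:P * 'X * chebyshevU R k.+1 - chebyshevU R k) !hornerE.
elim: n => [|n [IH1 IH2]].
  split=> //; rewrite jouk_exp_rec E1 E0 TS.
  have -> : (chebyshevT R 1).[x] = x by rewrite /= hornerE.
  have -> : (chebyshevT R 0).[x] = 1 by rewrite /= hornerE.
  have -> : (chebyshevU R 1).[x] = 2 * x by rewrite /= !hornerE.
  apply/eqP; rewrite eq_complex cReB cImB !cReM !cImM /=.
  by apply/andP; split; apply/eqP; ring.
split=> //; rewrite jouk_exp_rec IH1 IH2 (TS n.+1) US.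
apply/eqP; rewrite eq_complex cReB cImB !cReM !cImM.
move: (chebyshevT R n.+1).[x] (chebyshevT R n.+2).[x] => t1 t2.
move: (chebyshevU R n.+1).[x] (chebyshevU R n).[x] => u1 u2 /=.
by apply/andP; split; apply/eqP; ring.
Qed.

Lemma jouk_gt1 x : 1 < `|x| ->
  jouk x 0 = Complex (x - Num.sg x * Num.sqrt (x ^+ 2 - 1)) 0.
Proof.
move=> x1; rewrite /jouk jsqrt0_gt1//.
by apply/eqP; rewrite eq_complex cReB cImB /= subr0 !eqxx.
Qed.

Lemma complex_real_exp (a : R) n : Complex a 0 ^+ n = Complex (a ^+ n) 0.
Proof.
elim: n => [|n IH]; first by rewrite !expr0.
rewrite !exprS IH; apply/eqP; rewrite eq_complex cReM cImM /=.
by rewrite !mul0r mulr0 subr0 addr0 !eqxx.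
Qed.

Lemma Ttilde_jouk n x : Ttilde n x = Re (jouk x 0 ^+ n).
Proof.
rewrite /Ttilde; case: ifPn => [x1|]; last first.
  by rewrite -ltNge => x1; rewrite jouk_gt1// complex_real_exp.
case: n => [|n]; first by rewrite expr0 /= hornerE.
by rewrite jouk_exp_le1.
Qed.

Lemma chebW_jouk n x : chebW n x = - Im (jouk x 0 ^+ n.+1).
Proof.
rewrite /chebW /weight_half; case: ifPn => [x1|].
  by rewrite jouk_exp_le1 ?ltW//= opprK.
rewrite -leNgt mul0r le_eqVlt => /predU1P[x1|x1].
  rewrite jouk_exp_le1 -?x1//= opprK.
  by rewrite -(@real_normK _ x) ?num_real// -x1 expr1n subrr sqrtr0 mul0r.
by rewrite jouk_gt1// complex_real_exp /= oppr0.
Qed.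

Lemma jsqrt0_neq0 x : `|x| != 1 -> jsqrt x 0 != 0.
Proof.
move=> x1; apply/eqP => S0.
have := jsqrt_sqr x (lexx (0 : R)); rewrite S0 expr0n /= => /eqP.
rewrite eq_complex expr2 cReB cReM /= mulr0 subr0 => /andP[/eqP x2 _].
move/eqP: x1; apply; apply/eqP; rewrite -(@eqrXn2 _ 2)//.
by rewrite real_normK ?num_real// expr1n expr2; apply/eqP; lra.
Qed.

Lemma complex_div_imag (a b r : R) : r != 0 ->
  Complex a b / Complex 0 r = Complex (b / r) (- (a / r)).
Proof.
move=> r0; have n0 : Complex 0 r != 0 by rewrite eq_complex /= (negbTE r0) andbF.
apply: (mulIf n0); rewrite divfK//.
apply/eqP; rewrite eq_complex cReM cImM /=.
by apply/andP; split; apply/eqP; field.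
Qed.

Lemma complex_div_real (a r : R) : r != 0 ->
  Complex a 0 / Complex r 0 = Complex (a / r) 0.
Proof.
move=> r0; have n0 : Complex r 0 != 0 by rewrite eq_complex /= (negbTE r0).
apply: (mulIf n0); rewrite divfK//.
apply/eqP; rewrite eq_complex cReM cImM /=.
by apply/andP; split; apply/eqP; field.
Qed.

Lemma sqrt_neq0 (y : R) : 0 < y -> Num.sqrt y != 0.
Proof. by move=> y0; rewrite gt_eqF// sqrtr_gt0. Qed.

(** Inside (-1, 1) the root is purely imaginary, so dividing by it exchanges real and imaginary
    parts; outside everything is real and both sides vanish. *)
Lemma chebV_jouk n x : `|x| != 1 ->
  chebV n.+1 x = - Im (jouk x 0 ^+ n.+1 / jsqrt x 0).
Proof.
rewrite /chebV /weight_mhalf neq_lt => /orP[x1|x1].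
  have x2 : x ^+ 2 < 1 by rewrite -real_normK ?num_real// expr_lt1.
  rewrite x1 jouk_exp_le1 ?ltW// jsqrt0_le1 ?ltW//.
  by rewrite complex_div_imag ?sqrt_neq0 ?subr_gt0//= opprK mulrC.
have x2 : 1 < x ^+ 2 by rewrite -real_normK ?num_real// exprn_egt1.
rewrite ltNge ltW//= mul0r jouk_gt1// complex_real_exp jsqrt0_gt1//.
rewrite complex_div_real ?oppr0// mulf_neq0 ?sqrt_neq0 ?subr_gt0// sgr_eq0.
by apply/eqP => x0; move: x1; rewrite x0 normr0 ltr10.
Qed.

(** From w^2 = 1 - 2 w S, the quotients w^k / S satisfy the recurrence that defines [Utilde], with -
    2 Re w^k as increment. *)
Lemma Utilde_jouk n x : `|x| != 1 ->
  Utilde n x = - Re (jouk x 0 ^+ n.+1 / jsqrt x 0).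
Proof.
move=> x1; suff : Utilde n x = - Re (jouk x 0 ^+ n.+1 / jsqrt x 0) /\
  Utilde n.+1 x = - Re (jouk x 0 ^+ n.+2 / jsqrt x 0) by case.
have S0 := jsqrt0_neq0 x1.
set w := jouk x 0; set S := jsqrt x 0; rewrite -/S in S0.
have wS : w ^+ 2 = 1 - 2%:R * w * S.
  by rewrite -[X in X - _](jouk_mul x (lexx (0 : R))) -/w -/S /w /jouk -/S; ring.
have Re2 (z : R[i]) : Re (2%:R * z) = 2 * Re z by case: z => p q /=; ring.
have step k : w ^+ k.+3 / S = - (2%:R * w ^+ k.+2) + w ^+ k.+1 / S.
  by rewrite -addn2 exprD wS -[k.+2]addn1 exprD expr1; field.
have rec2 k : - Re (w ^+ k.+3 / S) = 2 * Ttilde k.+2 x - Re (w ^+ k.+1 / S).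
  rewrite step cReD Ttilde_jouk -/w.
  have ReN (z : R[i]) : Re (- z) = - Re z by case: z.
  by rewrite ReN Re2 opprD opprK.
(* The seeds of the recurrence. Since w / S = z / S - 1, the term [Ttilde 0] enters [Utilde 0] with
   coefficient 1 and not 2. *)
have ReV : Re (Complex x 0 / S) = - Utilde_m2 x /\ Re (S^-1) = - Utilde_m1 x.
  rewrite /Utilde_m2 /Utilde_m1 /S; move: x1; rewrite neq_lt => /orP[x1|x1].
    have x2 : x ^+ 2 < 1 by rewrite -real_normK ?num_real// expr_lt1.
    have sq0 : Num.sqrt (1 - x ^+ 2) != 0 by rewrite sqrt_neq0 ?subr_gt0.
    rewrite ltW// jsqrt0_le1 ?ltW//; split.
      by rewrite complex_div_imag//= mul0r oppr0.
    rewrite -[(Complex _ _)^-1]mul1r -[1]/(Complex 1 0 : R[i]).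
    by rewrite complex_div_imag//= mul0r oppr0.
  have x2 : 1 < x ^+ 2 by rewrite -real_normK ?num_real// exprn_egt1.
  have x0 : x != 0 by apply/eqP => x0; move: x1; rewrite x0 normr0 ltr10.
  rewrite leNgt x1 jsqrt0_gt1//.
  have sq0 : Num.sqrt (x ^+ 2 - 1) != 0 by rewrite sqrt_neq0 ?subr_gt0.
  have sg0 : Num.sg x != 0 by rewrite sgr_eq0.
  have sgx : x / Num.sg x = `|x| by rewrite {1}[x]numEsg mulrAC divff// mul1r.
  have sgV : (Num.sg x)^-1 = Num.sg x.
    by apply: (mulfI sg0); rewrite divff// -expr2 sqr_sg x0.
  split; first by rewrite complex_div_real ?mulf_neq0//= opprK invfM mulrA sgx.
  rewrite -[(Complex _ _)^-1]mul1r -[1]/(Complex 1 0 : R[i]).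
  by rewrite complex_div_real ?mulf_neq0//= opprK invfM mul1r sgV.
have [ReV1 ReV2] := ReV.
have b0 : Utilde 0 x = - Re (w ^+ 1 / S).
  rewrite expr1 [Utilde 0 x]/(Ttilde 0 x + Utilde_m2 x) /w /jouk -/S mulrBl.
  rewrite divff// cReB ReV1 Ttilde_jouk expr0.
  by rewrite opprB opprK.
have b1 : Utilde 1 x = - Re (w ^+ 2 / S).
  have -> : w ^+ 2 / S = S^-1 - 2%:R * w by rewrite wS; field.
  rewrite cReB ReV2 [Utilde 1 x]/(2 * Ttilde 1 x + Utilde_m1 x) Ttilde_jouk expr1 -/w.
  by rewrite Re2 opprB opprK.
elim: n => [|n [IH1 IH2]]; first by [].
split=> //; rewrite rec2 -[in RHS]IH1.
by [].
Qed.

End ChebyshevJoukowski.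

(** * Poisson integrals of W_n and Ttilde_n *)

Section ChebyshevWeight.
Variable R : realType.
Notation mu := (@lebesgue_measure R).
Notation Re := complex.Re.
Notation Im := complex.Im.
Notation normc := (@ComplexField.Normc.normc R).

Lemma sin_chebyshevU n (t : R) :
  sin (n.+1%:R * t) = sin t * (chebyshevU R n).[cos t].
Proof.
have US k : (chebyshevU R k.+2).[cos t] =
    2 * cos t * (chebyshevU R k.+1).[cos t] - (chebyshevU R k).[cos t].
  by rewrite [chebyshevU R k.+2]/(2%:P * 'X * chebyshevU R k.+1 - chebyshevU R k) !hornerE.
have sinS k : sin (k.+2%:R * t) = 2 * cos t * sin (k.+1%:R * t) - sin (k%:R * t).
  have -> : k.+2%:R * t = k.+1%:R * t + t by rewrite -natr1 mulrDl mul1r.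
  have -> : k%:R * t = k.+1%:R * t - t by rewrite -[k.+1%:R]natr1 mulrDl mul1r addrK.
  by rewrite sinD sinB; ring.
suff : sin (n.+1%:R * t) = sin t * (chebyshevU R n).[cos t] /\
  sin (n.+2%:R * t) = sin t * (chebyshevU R n.+1).[cos t] by case.
elim: n => [|n [IH1 IH2]].
  split; first by rewrite mul1r /= hornerE mulr1.
  have -> : (chebyshevU R 1).[cos t] = 2 * cos t by rewrite /= !hornerE.
  by rewrite sinS mul0r sin0 mul1r subr0 mulrC.
by split=> //; rewrite sinS IH1 IH2 US; ring.
Qed.

(** [Num.sqrt] is 0 on negative numbers, so the cut-off is built into this form, and continuity
    follows at once. *)
Lemma chebWE n (x : R) : chebW n x = Num.sqrt (1 - x ^+ 2) * (chebyshevU R n).[x].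
Proof.
rewrite /chebW /weight_half; case: ifPn => //; rewrite -leNgt => x1.
rewrite [X in _ = X * _]ler0_sqrtr ?mul0r//.
by rewrite subr_le0 -(@real_normK _ x) ?num_real// exprn_ege1.
Qed.

Lemma continuous_chebW n : continuous (@chebW R n).
Proof.
rewrite (funext (chebWE n)) => x.
apply: cvgM; last exact: continuous_horner.
apply: (@continuous_comp _ _ _ (fun x : R => 1 - x ^+ 2)); last exact: sqrt_continuous.
by apply: cvgB; [exact: cvg_cst|exact: exprn_continuous].
Qed.

Lemma measurable_chebW n : measurable_fun setT (@chebW R n).
Proof. exact: continuous_measurable_fun (@continuous_chebW n). Qed.

Lemma normr_chebW_le1 n (x : R) : `|chebW n x| <= 1.
Proof.
rewrite chebW_jouk normrN; apply: le_trans (normr_Im_le _) _.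
by apply: normc_exp_le1; exact: jouk_norm_le1.
Qed.

Lemma chebW_out n (x : R) : 1 <= `|x| -> chebW n x = 0.
Proof. by rewrite /chebW /weight_half ltNge => ->; rewrite mul0r. Qed.

Lemma normr_chebW_le n (x : R) : `|chebW n x| <= 2 * pker 1 x.
Proof.
have p1 : 0 <= pker 1 x by exact: pker_ge0.
have [x1|x1] := leP 1 `|x|.
  by rewrite chebW_out// normr0 mulr_ge0.
apply: le_trans (normr_chebW_le1 _ _) _.
rewrite /pker expr1n mul1r ler_pdivlMr; last by rewrite ltr_wpDl ?sqr_ge0.
by rewrite -(@real_normK _ x) ?num_real//; have := normr_ge0 x; nra.
Qed.

Lemma L1_chebW n : L1 (@chebW R n).
Proof.
apply: le_L1 (measurable_chebW n) (normr_chebW_le n) _.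
exact: (L1Zl 2 (Int_pker1 R).1).
Qed.

(** The substitution x = cos t gives the integral of sin t sin((n+1) t) over [0, pi], an
    orthogonality relation. *)
Lemma Int_chebW n : \int[mu]_x chebW n x = if n == 0%N then pi / 2 else 0.
Proof.
have -> : \int[mu]_x chebW n x = \int[mu]_(x in `[cos pi, cos 0]) chebW n x.
  rewrite [RHS]Rintegral_mkcond; apply: eq_Int => x; rewrite patchE.
  case: ifPn => //; rewrite notin_setE /= cospi cos0 in_itv/= => /negP.
  by rewrite -ler_norml -ltNge => /ltW; exact: chebW_out.
pose f k (t : R) := 2^-1 * (cos (k%:R * t) - cos (k.+2%:R * t)).
(* An antiderivative of cos(k t). The case k = 0 is the only one not vanishing at pi, and yields pi
   / 2. *)
pose c k (t : R) := if k is 0%N then t else k%:R^-1 * sin (k%:R * t).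
have dc k (t : R) : is_derive t 1 (c k) (cos (k%:R * t)).
  case: k => [|k]; first by rewrite mul0r cos0; exact: is_derive_id.
  rewrite /c; apply: is_derive_eq; rewrite /GRing.scale /=.
  by field; rewrite addrC natr1 pnatr_eq0.
have dF (t : R) : is_derive t 1 (fun t => 2^-1 * (c n t - c n.+2 t)) (f n t).
  have := is_deriveZ 2^-1 (is_deriveB (dc n t) (dc n.+2 t)); exact.
have cos' : derive1 (@cos R) = (fun t => - sin t).
  by apply/funext => t; rewrite derive1E; exact: derive_val.
have csin : continuous (fun t : R => - sin t).
  by move=> t; apply: cvgN; exact: continuous_sin.
have cF (F G : R -> R) : (forall t : R, is_derive t 1 F (G t)) -> continuous F.
  by move=> h t; apply/differentiable_continuous/derivable1_diffP; have [] := h t.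
have dLR (F G : R -> R) a b : (forall t : R, is_derive t 1 F (G t)) ->
    derivable_oo_LRcontinuous F a b.
  move=> h; split; first by move=> t _; have [] := h t.
    by apply: cvg_at_right_filter; exact: (cF _ _ h).
  by apply: cvg_at_left_filter; exact: (cF _ _ h).
rewrite /Rintegral.
rewrite (@integration_by_substitution_decreasing _ cos (chebW n) 0 pi).
- transitivity (fine (\int[mu]_(t in `[0, pi]) (f n t)%:E)).
    congr fine; apply: eq_integral => t; rewrite inE/= in_itv/= => tpi; congr _%:E.
    rewrite cos'; transitivity (chebW n (cos t) * - - sin t); first by [].
    rewrite opprK chebWE.
    have -> : 1 - cos t ^+ 2 = sin t ^+ 2 by rewrite sin2cos2.
    rewrite sqrtr_sqr ger0_norm ?sin_ge0_pi// -sin_chebyshevU /f.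
    have -> : n%:R * t = n.+1%:R * t - t by rewrite -[n.+1%:R]natr1 mulrDl mul1r addrK.
    have -> : n.+2%:R * t = n.+1%:R * t + t by rewrite -natr1 mulrDl mul1r.
    by rewrite cosB cosD; field.
  rewrite (@continuous_FTC2 _ _ (fun t => 2^-1 * (c n t - c n.+2 t))).
  + rewrite -EFinB -[LHS]/(2^-1 * (c n pi - c n.+2 pi) - 2^-1 * (c n 0 - c n.+2 0)).
    have sinpi k : sin (k%:R * pi) = 0 :> R.
      elim: k => [|k IH]; first by rewrite mul0r sin0.
      by rewrite -natr1 mulrDl mul1r sinD IH sinpi mul0r mulr0 addr0.
    have cpi k : c k pi = if k == 0%N then pi else 0.
      by case: k => [|k] //=; rewrite /c sinpi mulr0.
    have c0 k : c k 0 = 0 by case: k => [|k] //=; rewrite /c mulr0 sin0 mulr0.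
    by rewrite !cpi !c0; case: ifP => _ /=; ring.
  + exact: pi_gt0.
  + have ck k : continuous (fun t : R => cos (k%:R * t)).
      move=> t; apply: (@continuous_comp _ _ _ (fun t : R => k%:R * t) (@cos R));
        last exact: continuous_cos.
      by apply: cvgM; [exact: cvg_cst|exact: cvg_id].
    apply: continuous_subspaceT => t; apply: cvgM; first exact: cvg_cst.
    by apply: cvgB; exact: ck.
  + exact: dLR dF.
  + by move=> t _; rewrite derive1E; have [_ ->] := dF t.
- exact: pi_ge0.
- by move=> x y x0 y0; rewrite ltr_cos.
- by rewrite cos' => t _; exact: csin.
- rewrite cos'; apply: cvgP; apply: cvg_at_right_filter; exact: csin.
- rewrite cos'; apply: cvgP; apply: cvg_at_left_filter; exact: csin.
- exact: dLR (@is_derive_cos R).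
- exact: continuous_subspaceT (@continuous_chebW n).
Qed.

End ChebyshevWeight.

(** * Cauchy transforms of W_n at a point of the upper half-plane *)

Section CauchyTransform.
Variable R : realType.
Notation mu := (@lebesgue_measure R).
Notation Re := complex.Re.
Notation Im := complex.Im.
Notation normc := (@ComplexField.Normc.normc R).
Notation normcM := ComplexField.Normc.normcM.
Variables (x s : R).
Hypothesis s0 : 0 < s.

Let q (t : R) := qker s (x - t).
Let p (t : R) := pker s (x - t).
Let c n := \int[mu]_t (q t * chebW n t).
Let d n := \int[mu]_t (p t * chebW n t).
(** The integral of W_n(t) / (z - t) with z = x + i s, because 1 / (z - t) = q t - i p t. *)
Let C n : R[i] := Complex (c n) (- d n).
Let w := jouk x s.
Let v := Complex x s + jsqrt x s.

Let mq : measurable_fun setT q.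
Proof.
apply: (measurableT_comp (measurable_qker (lt0r_neq0 s0))).
exact: measurable_funB.
Qed.

Let mp : measurable_fun setT p.
Proof.
apply: (measurableT_comp (measurable_pker (lt0r_neq0 s0))).
exact: measurable_funB.
Qed.

Let p_le t : `|p t| <= s^-1.
Proof.
rewrite /p ger0_norm ?pker_ge0// /pker ler_pdivrMr ?sqrD_gt0 ?lt0r_neq0//.
rewrite ler_pdivlMl// -expr2 lerDr; exact: sqr_ge0.
Qed.

Let Lq n : L1 (fun t => q t * chebW n t).
Proof. apply: L1M_bounded mq (fun t => qker_le _ s0) _; exact: L1_chebW. Qed.

Let Lp n : L1 (fun t => p t * chebW n t).
Proof. apply: L1M_bounded mp p_le _; exact: L1_chebW. Qed.

(** With [tp], the real and imaginary parts of t / (z - t) = z / (z - t) - 1; the term - 1 is what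
    brings in the integral of W_n. *)
Let tq t : t * q t = x * q t - 1 + s * p t.
Proof. by rewrite /q /p /qker /pker; field; rewrite sqrD_neq0 ?lt0r_neq0. Qed.

Let tp t : t * p t = x * p t - s * q t.
Proof. by rewrite /q /p /qker /pker; field; rewrite sqrD_neq0 ?lt0r_neq0. Qed.

Let Int_tq n : \int[mu]_t (t * q t * chebW n t) =
  x * c n - \int[mu]_t chebW n t + s * d n /\ L1 (fun t => t * q t * chebW n t).
Proof.
have E t : t * q t * chebW n t =
  x * (q t * chebW n t) - chebW n t + s * (p t * chebW n t) by rewrite tq; ring.
have LW := @L1_chebW R n.
have L12 := L1B (L1Zl x (Lq n)) LW; have L3 := L1Zl s (Lp n).
split; last by apply: eq_L1 (fun t => esym (E t)) _; exact: L1D L12 L3.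
by rewrite (eq_Int E) (IntD L12 L3) (IntB (L1Zl x (Lq n)) LW) (IntZl _ (Lq n)) (IntZl _ (Lp n)).
Qed.

Let Int_tp n : \int[mu]_t (t * p t * chebW n t) = x * d n - s * c n /\
  L1 (fun t => t * p t * chebW n t).
Proof.
have E t : t * p t * chebW n t =
  x * (p t * chebW n t) - s * (q t * chebW n t) by rewrite tp; ring.
have L12 := L1Zl x (Lp n); have L3 := L1Zl s (Lq n).
split; last by apply: eq_L1 (fun t => esym (E t)) _; exact: L1B L12 L3.
by rewrite (eq_Int E) (IntB L12 L3) (IntZl _ (Lq n)) (IntZl _ (Lp n)).
Qed.

Let chebW1 (t : R) : chebW 1 t = 2 * t * chebW 0 t.
Proof.
rewrite /chebW; have -> : (chebyshevU R 1).[t] = 2 * t by rewrite /= !hornerE.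
have -> : (chebyshevU R 0).[t] = 1 by rewrite /= hornerE.
by rewrite mulr1 mulrC.
Qed.

Let chebWSS n (t : R) : chebW n.+2 t = 2 * t * chebW n.+1 t - chebW n t.
Proof.
have US : (chebyshevU R n.+2).[t] = 2 * t * (chebyshevU R n.+1).[t] - (chebyshevU R n).[t].
  by rewrite [chebyshevU R n.+2]/(2%:P * 'X * chebyshevU R n.+1 - chebyshevU R n) !hornerE.
by rewrite /chebW US mulrBr mulrCA.
Qed.

Let C1 : C 1 = 2%:R * Complex x s * C 0 - Complex pi 0.
Proof.
have e1 : c 1 = 2 * (x * c 0 - pi / 2 + s * d 0).
  have [I L] := Int_tq 0; rewrite Int_chebW /= in I; rewrite -I -IntZl//.
  by apply: eq_Int => t; rewrite chebW1; ring.
have e2 : d 1 = 2 * (x * d 0 - s * c 0).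
  have [I L] := Int_tp 0; rewrite -I -IntZl//.
  by apply: eq_Int => t; rewrite chebW1; ring.
apply/eqP; rewrite eq_complex cReB cImB !cReM !cImM /C e1 e2 /=.
by apply/andP; split; apply/eqP; field.
Qed.

Let CSS n : C n.+2 = 2%:R * Complex x s * C n.+1 - C n.
Proof.
have e1 : c n.+2 = 2 * (x * c n.+1 + s * d n.+1) - c n.
  have [I L] := Int_tq n.+1; rewrite Int_chebW subr0 in I.
  rewrite -I -IntZl// -(IntB (L1Zl 2 L) (Lq n)).
  by apply: eq_Int => t; rewrite chebWSS; ring.
have e2 : d n.+2 = 2 * (x * d n.+1 - s * c n.+1) - d n.
  have [I L] := Int_tp n.+1; rewrite -I -IntZl// -(IntB (L1Zl 2 L) (Lp n)).
  by apply: eq_Int => t; rewrite chebWSS; ring.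
apply/eqP; rewrite eq_complex cReB cImB !cReM !cImM /C e1 e2 /=.
by apply/andP; split; apply/eqP; ring.
Qed.

Let C_bounded : exists B, forall n, normc (C n) <= B.
Proof.
exists ((2 * s)^-1 * (2 * pi) + s^-1 * (2 * pi)) => n.
have h (g : R -> R) (b : R) : measurable_fun setT g -> (forall t, `|g t| <= b) ->
    `|\int[mu]_t (g t * chebW n t)| <= b * (2 * pi).
  move=> mg gb; have LW := @L1_chebW R n.
  rewrite -(Int_pker1 R).2 -IntZl; last exact: (Int_pker1 R).1.
  have L2 := L1Zl 2 (Int_pker1 R).1.
  rewrite -(IntZl _ L2); apply: normr_Int; [exact: L1M_bounded mg gb LW|exact: (L1Zl b L2)|].
  by move=> t; rewrite normrM; apply: ler_pM => //; exact: normr_chebW_le.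
have -> : C n = Complex (c n) 0 + Complex 0 (- d n).
  by apply/eqP; rewrite eq_complex cReD cImD /= addr0 add0r !eqxx.
apply: le_trans (normcD_le _ _) _; apply: lerD.
  rewrite /= expr0n addr0 sqrtr_sqr; apply: h mq _ => t; exact: qker_le.
by rewrite /= expr0n add0r sqrtr_sqr normrN; apply: h mp _ => t; exact: p_le.
Qed.

Lemma cauchy_chebW n : C n = Complex pi 0 * w ^+ n.+1.
Proof.
have wv : w * v = 1 by apply: jouk_mul; exact: ltW.
have wvD : w + v = 2%:R * Complex x s by rewrite /w /v /jouk; ring.
have w1 : normc w < 1 by exact: jouk_norm_lt1.
(* E k is the component of C along the growing solution w^-k. *)
pose E k := C k.+1 - w * C k.
have ES k : w * E k.+1 = E k.
  by rewrite /E CSS -wvD -[in RHS](mul1r (C k.+1)) -wv; ring.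
have E0k k : E 0 = w ^+ k * E k.
  by elim: k => [|k IH]; rewrite ?expr0 ?mul1r// IH -(ES k) exprSr mulrA.
have [B hB] := C_bounded.
have B0 : 0 <= B by exact: le_trans (normc_ge0 _) (hB 0%N).
have E0_le k : normc (E 0) <= normc w ^+ k * (B + B).
  rewrite (E0k k) normcM normcX; apply: ler_wpM2l; first by rewrite exprn_ge0 ?normc_ge0.
  apply: le_trans (normcB_le _ _) _; apply: lerD => //.
  rewrite normcM; apply: le_trans (hB k).
  by apply: ler_piMl; [exact: normc_ge0|exact: ltW].
have E00 : E 0 = 0.
  apply: ComplexField.Normc.eq0_normc; apply/eqP; rewrite eq_le normc_ge0 andbT.
  have wB : normc w ^+ k * (B + B) @[k --> \oo] --> (0 : R).
    rewrite -[X in _ --> X](mul0r (B + B)); apply: cvgM; last exact: cvg_cst.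
    by apply: cvg_expr; rewrite ger0_norm ?normc_ge0.
  by apply: (cvgr_to_ge wB); exact: nearW.
have Ek k : E k = 0.
  have w0 : w != 0.
    by apply/eqP => w0; move: wv; rewrite w0 mul0r => /eqP; rewrite eq_sym oner_eq0.
  apply/eqP; move: (E0k k); rewrite E00 => /esym/eqP.
  by rewrite mulf_eq0 expf_eq0 (negbTE w0) andbF.
have CS k : C k.+1 = w * C k by apply/eqP; rewrite -subr_eq0 -[_ - _]/(E k) Ek.
(* Comparing C 1 = w C 0 with C 1 = (w + v) C 0 - pi leaves v C 0 = pi, and w is the inverse of
   v. *)
have C0 : C 0 = Complex pi 0 * w.
  have : v * C 0 = Complex pi 0.
    have E1 : v * C 0 - Complex pi 0 = C 1 - w * C 0 by rewrite C1 -wvD; ring.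
    by apply/eqP; rewrite -subr_eq0 E1 CS subrr.
  by move=> <-; rewrite mulrAC [v * w]mulrC wv mul1r.
by elim: n => [|n IH]; rewrite ?expr1// CS IH [in RHS]exprS; ring.
Qed.

End CauchyTransform.

(** * From Cauchy transforms to Poisson integrals *)

Section PoissonFormulas.
Variable R : realType.
Notation mu := (@lebesgue_measure R).
Notation Re := (@complex.Re R).
Notation Im := (@complex.Im R).
Notation normc := (@ComplexField.Normc.normc R).

Lemma pkerBC e (x y : R) : pker e (x - y) = pker e (y - x).
Proof. by rewrite -pkerN opprB. Qed.

Lemma Int_chebW_pker n e (x : R) : 0 < e ->
  \int[mu]_y (chebW n y * pker e (y - x)) = pi * - Im (jouk x e ^+ n.+1).
Proof.
move=> e0; have /(congr1 Im) := cauchy_chebW x e0 n.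
rewrite cImM /= mul0r addr0 mulrN => <-; rewrite opprK.
by apply: eq_Int => y; rewrite pkerBC mulrC.
Qed.

Lemma Int_chebW_qker n e (x : R) : 0 < e ->
  \int[mu]_y (qker e (x - y) * chebW n y) = pi * Re (jouk x e ^+ n.+1).
Proof.
move=> e0; have /(congr1 Re) := cauchy_chebW x e0 n.
by rewrite cReM /= mul0r subr0 => <-.
Qed.

Lemma measurable_sg : measurable_fun setT (@Num.sg R).
Proof.
have -> : @Num.sg R = fun x => x / `|x|.
  apply/funext => x; have [->|x0] := eqVneq x 0; first by rewrite sgr0 mul0r.
  by rewrite {2}[x]numEsg mulfK// normr_eq0.
apply: measurable_funM => //.
by apply: (measurableT_comp (@measurable_inv R)); exact: normr_measurable.
Qed.

Lemma measurable_sqrt : measurable_fun setT (@Num.sqrt R).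
Proof. exact: continuous_measurable_fun (@sqrt_continuous R). Qed.

Lemma measurable_le1 : measurable_fun setT (fun x : R => `|x| <= 1).
Proof. by apply: measurable_fun_ler => //; exact: normr_measurable. Qed.

Lemma measurable_Ttilde n : measurable_fun setT (@Ttilde R n).
Proof.
apply: measurable_fun_ifT; first exact: measurable_le1.
  by apply: continuous_measurable_fun; exact: continuous_horner.
apply: measurable_funX; apply: measurable_funB => //.
apply: measurable_funM; first exact: measurable_sg.
by apply: (measurableT_comp measurable_sqrt); apply: measurable_funB => //.
Qed.

Lemma ae_normr_neq1 : {ae mu, forall x : R, `|x| != 1}.
Proof.
exists [set 1; - 1]; split.
- by apply: measurableU; exact: measurable_set1.
- by apply: countable_lebesgue_measure0; exact: finite_set_countable.
- move=> x /= /negP; rewrite negbK eqr_norml => /andP[/orP[/eqP->|/eqP->] _]; [by left|by right].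
Qed.

Lemma Ttilde_le1 n (x : R) : `|Ttilde n x| <= 1.
Proof.
rewrite Ttilde_jouk; apply: le_trans (normr_Re_le _) _.
by apply: normc_exp_le1; exact: jouk_norm_le1.
Qed.

Let u n d (y : R) := Re (jouk y d ^+ n.+1).

Let u_le1 n d y : 0 <= d -> `|u n d y| <= 1.
Proof.
move=> d0; apply: le_trans (normr_Re_le _) _.
by apply: normc_exp_le1; exact: jouk_norm_le1.
Qed.

(** By [Int_chebW_qker], pi times [u n d] is the convolution of W_n with the conjugate kernel.
    Fubini lets the Poisson kernel act on that kernel first; d > 0 provides the bound (2 d)^-1 that
    it requires. *)
Let Int_u_pker n d e (x : R) : 0 < d -> d < e ->
  L1 (fun y => u n d y * pker e (y - x)) /\
  \int[mu]_y (u n d y * pker e (y - x)) = pi * u n (e + d) x.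
Proof.
move=> d0 de; have e0 : 0 < e by rewrite (lt_trans d0).
have pi0 : (pi : R) != 0 by rewrite gt_eqF// pi_gt0.
have LW := @L1_chebW R n.
have dn := lt0r_neq0 d0; have en := lt0r_neq0 e0.
pose F (z : R * R) := qker d (z.1 - z.2) * chebW n z.2 * pker e (z.1 - x).
have mF : measurable_fun setT F.
  apply: measurable_funM.
    apply: measurable_funM.
      apply: (measurableT_comp (measurable_qker dn)).
      by apply: measurable_funB => //; exact: measurable_snd.
    by apply: (measurableT_comp (measurable_chebW n)); exact: measurable_snd.
  by apply: (measurableT_comp (measurable_pker en)); exact: measurable_funB.
have mq t : measurable_fun setT (fun y : R => qker d (y - t)).
  by apply: (measurableT_comp (measurable_qker dn)); exact: measurable_funB.
have mq' y : measurable_fun setT (fun t : R => qker d (y - t)).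
  by apply: (measurableT_comp (measurable_qker dn)); exact: measurable_funB.
have Lpx := L1_translate (- x) (L1_pker e0).
have F1 t : L1 (fun y => F (y, t)).
  apply: (@eq_L1 _ (fun y => chebW n t * (qker d (y - t) * pker e (y - x)))).
    by move=> y; rewrite /F /=; ring.
  apply: (L1Zl (chebW n t)); exact: L1M_bounded (mq t) (fun y => qker_le _ d0) Lpx.
have F2 y : L1 (fun t => F (y, t)).
  apply: (@eq_L1 _ (fun t => pker e (y - x) * (qker d (y - t) * chebW n t))).
    by move=> t; rewrite /F /=; ring.
  apply: (L1Zl (pker e (y - x))); exact: L1M_bounded (mq' y) (fun t => qker_le _ d0) LW.
have Fh t : \int[mu]_y `|F (y, t)| <= (2 * d)^-1 * pi * `|chebW n t|.
  rewrite -(Int_pker e0) -(Int_translate (- x) (L1_pker e0)) mulrAC -(IntZl _ Lpx).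
  apply: le_Int; [exact: L1_norm|exact: (L1Zl _ Lpx)|move=> y].
  rewrite /F /= (normrM (_ * _)) (normrM (qker _ _)) (ger0_norm (pker_ge0 _ e0)).
  apply: ler_wpM2r; first exact: pker_ge0.
  by apply: ler_wpM2r => //; exact: qker_le.
have hL : L1 (fun t => (2 * d)^-1 * pi * `|chebW n t|).
  by apply: (L1Zl ((2 * d)^-1 * pi)); exact: L1_norm.
have [G1 G2 GE] := Int_fubini mF F1 F2 Fh hL.
have E1 y : \int[mu]_t F (y, t) = pi * (u n d y * pker e (y - x)).
  rewrite mulrA -(Int_chebW_qker n y d0) mulrC.
  rewrite -(IntZl _ (L1M_bounded (mq' y) (fun t => qker_le _ d0) LW)).
  by apply: eq_Int => t; rewrite /F /=; ring.
have ed0 : 0 < e + d by rewrite addr_gt0.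
have E2 t : \int[mu]_y F (y, t) = pi * (qker (e + d) (x - t) * chebW n t).
  rewrite mulrA -(Int_pker_qker (x - t) d0 de) mulrC.
  have Lk : L1 (fun y => qker d (y - t) * pker e (y - x)).
    exact: L1M_bounded (mq t) (fun y => qker_le _ d0) Lpx.
  rewrite -[X in _ * X](_ : \int[mu]_y (qker d (y - t) * pker e (y - x)) = _).
    by rewrite -(IntZl _ Lk); apply: eq_Int => y; rewrite /F /=; ring.
  rewrite -(Int_translate t Lk); apply: eq_Int => y.
  by rewrite addrK mulrC opprB addrA.
have LU : L1 (fun y => u n d y * pker e (y - x)).
  apply: (@eq_L1 _ (fun y => pi^-1 * \int[mu]_t F (y, t))).
    by move=> y; rewrite E1 mulKf.
  exact: (L1Zl pi^-1 G2).
split=> //; apply: (mulfI pi0).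
rewrite -(IntZl pi LU) -(eq_Int E1) GE (eq_Int E2) IntZl; last first.
  apply: L1M_bounded _ (fun t => qker_le _ ed0) LW.
  apply: (measurableT_comp (measurable_qker (lt0r_neq0 ed0))); exact: measurable_funB.
by rewrite Int_chebW_qker.
Qed.

Let u_cvg n (y : R) (d : nat -> R) : `|y| != 1 -> (forall m, 0 <= d m) ->
  d m @[m --> \oo] --> (0 : R) -> u n (d m) y @[m --> \oo] --> Ttilde n.+1 y.
Proof.
move=> y1 d0 dc; have S0 := jsqrt0_neq0 y1.
set K := n.+1%:R * (2 / normc (jsqrt y 0)).
have Kd : K * d m @[m --> \oo] --> (0 : R).
  by rewrite -[X in _ --> X](mulr0 K); apply: cvgM; [exact: cvg_cst|exact: dc].
apply/cvgrPdist_le => e e0.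
apply: filterS (cvgr_lt _ Kd _ e0) => m he.
apply: ltW; apply: le_lt_trans he.
rewrite distrC Ttilde_jouk /u -cReB; apply: le_trans (normr_Re_le _) _.
apply: le_trans (normc_expB_le _ (jouk_norm_le1 _ (d0 m)) (jouk_norm_le1 _ (lexx _))) _.
rewrite /K -mulrA; apply: ler_wpM2l => //; exact: jouk_diff_norm.
Qed.

Lemma Int_Ttilde_pker n e (x : R) : 0 < e ->
  \int[mu]_y (Ttilde n.+1 y * pker e (y - x)) = pi * Re (jouk x e ^+ n.+1).
Proof.
move=> e0.
(* Ttilde is approached from height d m, and the kernel of height e - d m then
   lands exactly at height e. *)
pose d m : R := e / 4 * harmonic m.
have d0 m : 0 < d m by rewrite mulr_gt0 ?harmonic_gt0// divr_gt0.
have dle m : d m <= e / 4.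
  apply: ler_piMr; first by rewrite divr_ge0// ltW.
  by rewrite /harmonic /= invf_le1 ?ltr0Sn// ler1n.
have dc : d m @[m --> \oo] --> (0 : R).
  rewrite -[X in _ --> X](mulr0 (e / 4)).
  by apply: cvgM; [exact: cvg_cst|exact: cvg_harmonic].
have ed m : d m < e - d m by have := dle m; lra.
have ed0 m : 0 < e - d m by exact: lt_trans (ed m).
have H m := Int_u_pker n x (d0 m) (ed m).
have e2 : 0 < e / 2 by rewrite divr_gt0.
have [_ lim] : L1 (fun y => Ttilde n.+1 y * pker e (y - x)) /\
    \int[mu]_y (u n (d m) y * pker (e - d m) (y - x)) @[m --> \oo] -->
    \int[mu]_y (Ttilde n.+1 y * pker e (y - x)).
  (* Since 0 < d m <= e / 4, the height e - d m lies between e / 2 and e = 2 (e / 2): the numerator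
     is bounded by the latter, the denominator from below by the former. *)
  apply: (@Int_cvg R _ _ (fun y => 2 * pker (e / 2) (y - x))).
  - by move=> m; exact: L1_measurable (H m).1.
  - apply: measurable_funM; first exact: measurable_Ttilde.
    apply: (measurableT_comp (measurable_pker (lt0r_neq0 e0))); exact: measurable_funB.
  - apply: aeS ae_normr_neq1 => y y1; apply: cvgM.
      by apply: u_cvg => // m; exact: ltW.
    have ec : (e - d m) @[m --> \oo] --> e.
      by rewrite -[X in _ --> X]subr0; apply: cvgB; [exact: cvg_cst|exact: dc].
    apply: cvgM => //; apply: cvgV; first by rewrite sqrD_neq0 ?lt0r_neq0.
    apply: cvgD; first exact: cvg_cst.
    exact: (cvg_comp _ _ ec (@exprn_continuous _ 2 _)).
  - exact: (L1Zl 2 (L1_translate (- x) (L1_pker e2))).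
  - apply: aeW => y m; rewrite normrM; apply: (@le_trans _ _ (1 * `|pker (e - d m) (y - x)|)).
      by apply: ler_wpM2r => //; apply: u_le1; exact: ltW.
    rewrite mul1r ger0_norm ?pker_ge0// /pker mulrA.
    have A0 : 0 < (y - x) ^+ 2 + (e / 2) ^+ 2 by rewrite sqrD_gt0// lt0r_neq0.
    have B0 : 0 < (y - x) ^+ 2 + (e - d m) ^+ 2 by rewrite sqrD_gt0// lt0r_neq0.
    apply: ler_pM; [exact: ltW|by rewrite invr_ge0 ltW| |].
      by have := d0 m; lra.
    rewrite lef_pV2 ?posrE// lerD2l ler_sqr ?nnegrE; [|exact: ltW|exact: ltW].
    by have := dle m; lra.
have E m : \int[mu]_y (u n (d m) y * pker (e - d m) (y - x)) = pi * u n e x.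
  by rewrite (H m).2 subrK.
move: lim; rewrite (funext E) => lim.
exact: (cvg_unique _ lim (cvg_cst _)).
Qed.

End PoissonFormulas.

(** * Endpoint singularities and rescaling *)

Section EndpointSingularity.
Variable R : realType.
Notation mu := (@lebesgue_measure R).
Notation Re := (@complex.Re R).
Notation Im := (@complex.Im R).
Notation normc := (@ComplexField.Normc.normc R).
Implicit Types x : R.

Lemma Lfun2_sqr (u : R -> R) : measurable_fun setT u ->
  L1 (fun x => u x ^+ 2) -> u \in Lfun mu 2%:E.
Proof.
move=> mu' uL; apply/andP; split; first by rewrite inE.
rewrite inE /= /finite_norm unlock /Lnorm; apply: poweR_lty.
have -> : (\int[mu]_x (`|(EFin \o u) x| `^ 2) = \int[mu]_x (u x ^+ 2)%:E)%E.
  by apply: eq_integral => x _ /=; rewrite powR_mulrn// real_normK ?num_real.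
exact: integrable_lty uL.
Qed.

Lemma is_derive_sqrt2 x : 0 < x ->
  is_derive x 1 (fun y : R => 2 * Num.sqrt y) (Num.sqrt x)^-1.
Proof.
move=> x0; have := is_deriveZ 2 (is_derive1_sqrt x0).
rewrite /GRing.scale /= invfM mulrA divff ?mul1r//.
Qed.

Lemma measurable_sqrtV : measurable_fun setT (fun x : R => (Num.sqrt `|x|)^-1).
Proof.
apply: (measurableT_comp (@measurable_inv R)).
by apply: (measurableT_comp (@measurable_sqrt R)); exact: normr_measurable.
Qed.

Let k x := (Num.sqrt `|x|)^-1.

Let k_ge0 x : 0 <= k x. Proof. by rewrite invr_ge0 sqrtr_ge0. Qed.

(** On [1 / (n+1), 1] the antiderivative 2 sqrt x gives at most 2; monotone convergence carries this
    bound to the union. *)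
Let kpos : (\int[mu]_(x in `]0%R, 1%R]) (k x)%:E < +oo)%E.
Proof.
pose F (n : nat) := `[n.+1%:R^-1, 1 : R]%classic.
have F0 n : 0 < (n.+1%:R^-1 : R) by rewrite invr_gt0 ltr0Sn.
have -> : `]0, 1 : R]%classic = \bigcup_n F n.
  apply/seteqP; split=> x /=; rewrite in_itv/=.
    move=> /andP[x0 x1]; exists (Num.trunc x^-1); first by [].
    rewrite /F /= in_itv/= x1 andbT.
    by rewrite invf_ple ?posrE// ltW// truncnS_gt.
  by move=> [n _]; rewrite /F /= in_itv/= => /andP[nx ->]; rewrite (lt_le_trans (F0 n)).
have nF : nondecreasing_seq F.
  move=> m n mn; apply/subsetPset => x; rewrite /F /= !in_itv/= => /andP[mx ->].
  by rewrite andbT (le_trans _ mx)// lef_pV2 ?posrE// ler_nat.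
have mk : measurable_fun setT (fun x => (k x)%:E).
  by apply/measurable_EFinP; exact: measurable_sqrtV.
have cv : (\int[mu]_(x in F n) (k x)%:E @[n --> \oo] -->
    \int[mu]_(x in \bigcup_n F n) (k x)%:E)%E.
  apply: ge0_nondecreasing_set_cvg_integral => //.
  - by move=> n; exact: measurable_itv.
  - by move=> n; exact: measurable_funTS mk.
  - by move=> n x _; rewrite lee_fin.
apply: (@le_lt_trans _ _ 2%:E); last exact: ltry.
have bd n : (\int[mu]_(x in F n) (k x)%:E <= 2%:E)%E.
  have [n1|n1] := ltP (n.+1%:R^-1 : R) 1; last first.
    have -> : (\int[mu]_(x in F n) (k x)%:E = 0)%E.
      have : n.+1%:R^-1 = 1 :> R.
        by apply/eqP; rewrite eq_le n1 andbT invf_le1 ?ltr0Sn// ler1n.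
      by rewrite /F => ->; rewrite set_itv1 integral_set1.
    by rewrite lee_fin.
  rewrite (@continuous_FTC2 _ k (fun y => 2 * Num.sqrt y))//.
  - by rewrite -EFinB lee_fin sqrtr1 mulr1 gerBl mulr_ge0 ?sqrtr_ge0.
  - apply: continuous_in_subspaceT => y; rewrite inE /= in_itv/= => /andP[ny _].
    have y0 : 0 < y by exact: lt_le_trans ny.
    apply: cvgV; first by rewrite sqrt_neq0// normr_gt0 gt_eqF.
    apply: (@continuous_comp _ _ _ (fun y : R => `|y|) (@Num.sqrt R)); first exact: norm_continuous.
    exact: sqrt_continuous.
  - have dF y : 0 < y -> {for y, continuous (fun y : R => 2 * Num.sqrt y)}.
      by move=> y0; apply: cvgM; [exact: cvg_cst|exact: sqrt_continuous].
    split.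
    + move=> y; rewrite in_itv/= => /andP[ny _].
      by have [] := is_derive_sqrt2 (lt_trans (F0 n) ny).
    + by apply: cvg_at_right_filter; exact: dF.
    + by apply: cvg_at_left_filter; exact: dF.
  - move=> y; rewrite in_itv/= => /andP[ny _]; have y0 := lt_trans (F0 n) ny.
    by rewrite derive1E; have [_ ->] := is_derive_sqrt2 y0; rewrite /k gtr0_norm.
apply: (cvge_to_le cv); exact: nearW.
Qed.

(** The function is integrable near 0 but not at infinity: [H] takes the part within distance 1 of
    0, and the rest is at most 1. *)
Lemma sqrtV_split : exists2 H : R -> R, L1 H &
  forall x, 0 <= H x /\ (Num.sqrt `|x|)^-1 <= H x + 1.
Proof.
pose Hp x := k x * \1_(`]0, 1]%classic : set R) x.
have mI : measurable (`]0, 1 : R]%classic) by exact: measurable_itv.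
have LH : L1 Hp.
  apply: L1_ge0P.
  - by apply: measurable_funM; [exact: measurable_sqrtV|exact: measurable_indic].
  - by move=> x; rewrite mulr_ge0.
  - rewrite (_ : (\int[mu]_x (Hp x)%:E)%E = (\int[mu]_(x in `]0%R, 1%R]) (k x)%:E)%E)//.
    rewrite [RHS]integral_mkcond; apply: eq_integral => x _.
    rewrite patchE /Hp indicE; case: ifPn => xI; rewrite ?mulr1 ?mulr0//.
exists (fun x => Hp x + Hp (0 - x)); first by apply: L1D => //; exact: L1_reflect.
move=> x; split; first by rewrite addr_ge0// mulr_ge0.
have Hp0 y : 0 <= Hp y by rewrite mulr_ge0.
have [x1|x1] := leP `|x| 1; last first.
  have : k x <= 1.
    by rewrite invf_le1 ?sqrtr_gt0 ?(lt_trans ltr01)// -[leLHS]sqrtr1 ler_wsqrtr// ltW.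
  by have := Hp0 x; have := Hp0 (0 - x); rewrite -/(k x); lra.
have [x0|x0|->] := ltrgtP x 0.
- have : Hp (0 - x) = k x.
    rewrite /Hp /k sub0r normrN indicE mem_set ?mulr1//= in_itv/= oppr_gt0 x0/=.
    by rewrite -(ltr0_norm x0).
  by have := Hp0 x; rewrite -/(k x); lra.
- have : Hp x = k x.
    by rewrite /Hp indicE mem_set ?mulr1//= in_itv/= x0 -(gtr0_norm x0).
  by have := Hp0 (0 - x); rewrite -/(k x); lra.
- by rewrite normr0 sqrtr0 invr0 !addr_ge0.
Qed.

(** This is 1 / sqrt |x^2 - 1|, with default value 0 at the two endpoints. *)
Definition jsing x : R := (normc (jsqrt x 0))^-1.

Lemma jsingE x : jsing x = (Num.sqrt `|x - 1|)^-1 * (Num.sqrt `|x + 1|)^-1.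
Proof.
rewrite -invfM -sqrtrM// -normrM /jsing; congr _^-1.
have := congr1 normc (jsqrt_sqr x (lexx (0 : R))).
rewrite normcX expr2 => h.
have -> : normc (jsqrt x 0) = Num.sqrt (normc (jsqrt x 0) ^+ 2).
  by rewrite sqrtr_sqr ger0_norm// normc_ge0.
rewrite expr2 h; congr Num.sqrt.
have -> : Complex x 0 ^+ 2 - 1 = Complex ((x - 1) * (x + 1)) 0.
  apply/eqP; rewrite eq_complex expr2 cReB cImB cReM cImM /=.
  by apply/andP; split; apply/eqP; ring.
by rewrite /= expr0n addr0 sqrtr_sqr.
Qed.

Lemma jsing_ge0 x : 0 <= jsing x.
Proof. by rewrite invr_ge0 normc_ge0. Qed.

Lemma measurable_jsing : measurable_fun setT jsing.
Proof.
rewrite (funext jsingE); apply: measurable_funM.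
  by apply: (measurableT_comp measurable_sqrtV); exact: measurable_funB.
by apply: (measurableT_comp measurable_sqrtV); exact: measurable_funD.
Qed.

Lemma jsing_split : exists2 H : R -> R, L1 H & forall x, jsing x <= H x + 2.
Proof.
have [H LH hH] := sqrtV_split.
exists (fun x => H (x + - 1) + H (x + 1)).
  by apply: L1D; exact: L1_translate.
move=> x; have [h1 k1] := hH (x + - 1); have [h2 k2] := hH (x + 1).
apply: (@le_trans _ _ (k (x - 1) + k (x + 1))); last first.
  by rewrite /k; lra.
rewrite jsingE -/(k _) -/(k (x + 1)) /k.
set A := Num.sqrt `|x - 1|; set B := Num.sqrt `|x + 1|.
have A0 : 0 <= A by exact: sqrtr_ge0.
have B0 : 0 <= B by exact: sqrtr_ge0.
have [->|An] := eqVneq A 0; first by rewrite invr0 mul0r add0r invr_ge0.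
have [->|Bn] := eqVneq B 0; first by rewrite invr0 mulr0 addr0 invr_ge0.
(* The distances from x to 1 and to -1 add up to at least 2. Hence A + B >= 1, and 1 / (A B) <= 1 /
   A + 1 / B. *)
have AB : 2 <= A ^+ 2 + B ^+ 2.
  rewrite !sqr_sqrtr//.
  have := ler_norm (x + 1); have := ler_norm (- (x - 1)); rewrite normrN; lra.
have Ap : 0 < A by rewrite lt_neqAle eq_sym An.
have Bp : 0 < B by rewrite lt_neqAle eq_sym Bn.
have -> : A^-1 + B^-1 = (A + B) * (A^-1 * B^-1) by field; rewrite An Bn.
apply: ler_peMl; first by rewrite mulr_ge0 ?invr_ge0.
by nra.
Qed.

End EndpointSingularity.

Lemma pker_scaleM (R : realType) (c e x : R) : c != 0 ->
  pker e x = c * pker (c * e) (c * x).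
Proof.
move=> c0; rewrite /pker (_ : (c * x) ^+ 2 + _ = c ^+ 2 * (x ^+ 2 + e ^+ 2)); last by ring.
by rewrite mulrA [c * (c * e)]mulrA -expr2 -mulf_div divff ?mul1r// expf_neq0.
Qed.

(** * Transport from [-1, 1] to [a, b] *)

Section Scaling.
Variable R : realType.
Notation mu := (@lebesgue_measure R).
Variables (a b : R).
Hypothesis hab : a < b.

Let c : R := 2 / (b - a).
Let d : R := - (c * ((a + b) / 2)).

Let c_gt0 : 0 < c. Proof. by rewrite divr_gt0// subr_gt0. Qed.

Let c_neq0 : c != 0. Proof. exact: lt0r_neq0. Qed.

Let to_unitE x : to_unit a b x = c * x + d.
Proof. by rewrite /to_unit /d -/c mulrBr. Qed.

Lemma normr_to_unit_neq1 x : (~` [set a; b]) x -> `|to_unit a b x| != 1.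
Proof.
move=> /= xab; apply/negP; rewrite eqr_norml ler01 andbT.
have ba0 : b - a != 0 by rewrite subr_eq0 gt_eqF.
have E : x = (b - a) / 2 * to_unit a b x + (a + b) / 2.
  by rewrite /to_unit; field.
by move=> /orP[] /eqP h; apply: xab; rewrite E h; [right|left]; field.
Qed.

Let ae_to_unit : {ae mu, forall x : R, `|to_unit a b x| != 1}.
Proof.
exists [set a; b]; split.
- by apply: measurableU; exact: measurable_set1.
- by apply: countable_lebesgue_measure0; exact: finite_set_countable.
- by move=> x; apply: contra_notP; exact: normr_to_unit_neq1.
Qed.

Let measurable_to_unit (f : R -> R) : measurable_fun setT f ->
  measurable_fun setT (fun x => f (to_unit a b x)).
Proof.
move=> mf; apply: (measurableT_comp mf).
rewrite (funext to_unitE); exact: measurable_affine.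
Qed.

Let L1_to_unit (f : R -> R) : L1 f -> L1 (fun x => f (to_unit a b x)).
Proof. by move=> /(L1_affine d c_neq0); apply: eq_L1 => x; rewrite to_unitE. Qed.

(** A common interface for the two formulas: [U0] is the boundary function, [U] its Poisson
    extension, [f] minus its slope in the height at 0. The square bound with [K] gives membership in
    L^2. *)
Variables (N : nat) (K : R) (U0 f : R -> R) (U : R -> R -> R).
Hypothesis mU0 : measurable_fun setT U0.
Hypothesis U0_le1 : forall x, `|U0 x| <= 1.
Hypothesis U0_sqr : forall x, U0 x ^+ 2 <= K * pker 1 x.
Hypothesis Int_U0 : forall e x, 0 < e ->
  \int[mu]_y (U0 y * pker e (y - x)) = pi * U e x.
Hypothesis U0_U : forall e x, 0 < e -> `|x| != 1 ->
  `|U0 x - U e x| <= N%:R * (2 * jsing x * e).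
Hypothesis U_cvg : forall x (h : nat -> R), `|x| != 1 -> (forall m, 0 < h m) ->
  h m @[m --> \oo] --> (0 : R) ->
  (U0 x - U (h m) x) / h m @[m --> \oo] --> f x.
Hypothesis mf : measurable_fun setT f.
Hypothesis f_le : forall x, `|f x| <= N%:R * jsing x.

(** Stretching the line by c turns height e into height c e. Differentiating in e then produces the
    factor c = 2 / (b - a) of the theorem. *)
Let Int_U0_scaled e x : 0 < e ->
  \int[mu]_y (U0 (to_unit a b y) * pker e (y - x)) = pi * U (c * e) (to_unit a b x).
Proof.
move=> e0; have ce0 : 0 < c * e by rewrite mulr_gt0.
rewrite -Int_U0//.
pose g z := U0 z * pker (c * e) (z - to_unit a b x).
have Lg : L1 g by apply: L1M_bounded mU0 U0_le1 _; exact/L1_translate/L1_pker.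
have -> : \int[mu]_y (U0 (to_unit a b y) * pker e (y - x)) =
    \int[mu]_y (c * g (c * y + d)).
  apply: eq_Int => y; rewrite /g !to_unitE [RHS]mulrCA; congr (_ * _).
  have -> : c * y + d - (c * x + d) = c * (y - x) by ring.
  exact: pker_scaleM.
rewrite (IntZl _ (L1_affine d c_neq0 Lg)) (Int_affine d c_neq0 Lg).
by rewrite gtr0_norm// mulVKf.
Qed.

Let F x := c * f (to_unit a b x).

Let mF : measurable_fun setT F.
Proof. by apply: measurable_funM => //; exact: measurable_to_unit. Qed.

Let jsing_to_unit : exists2 H : R -> R, L1 H &
  forall x, 0 <= H x /\ jsing (to_unit a b x) <= H x + 2.
Proof.
have [H LH hH] := jsing_split R.
exists (fun x => `|H (to_unit a b x)|); first by apply: L1_norm; exact: L1_to_unit.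
move=> x; split => //; apply: le_trans (hH _) _.
by rewrite lerD2r ler_norm.
Qed.

Let F_le x : `|F x| <= c * N%:R * jsing (to_unit a b x).
Proof. by rewrite normrM gtr0_norm// -mulrA; apply: ler_wpM2l => //; exact: ltW. Qed.

Let F_locally_integrable : locally_integrable setT F.
Proof.
split; [exact: mF|exact: openT|move=> A _ cA].
have mA : measurable A by exact: compact_measurable.
have [M [Mr hM]] : bounded_set A by exact: compact_bounded.
have {}hM x : A x -> `|x| <= `|M| + 1.
  by move=> Ax; apply: (hM (`|M| + 1)) => //; rewrite ltr_pwDr// ler_norm.
have [H LH hH] := jsing_to_unit.
(* On the bounded set [A] one has 1 <= B [pker 1 x], which makes the constant 2 in the bound of
   [jsing] integrable. *)
pose B := (`|M| + 1) ^+ 2 + 1.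
have LA : L1 (F \_ A).
  apply: (@le_L1 _ _ (fun x => c * N%:R * (H x + 2 * B * pker 1 x))).
  - by apply/(measurable_restrictT _ _).1 => //; exact: measurable_funTS.
  - move=> x; have [h0 h1] := hH x.
    have cN : 0 <= c * N%:R by rewrite mulr_ge0// ltW.
    have p0 : 0 <= pker 1 x by exact: pker_ge0.
    have B0 : 0 <= B by rewrite addr_ge0// sqr_ge0.
    rewrite patchE; case: ifPn => [/set_mem Ax|_]; last first.
      by rewrite normr0 mulr_ge0// addr_ge0// mulr_ge0// mulr_ge0.
    apply: le_trans (F_le x) _; apply: ler_wpM2l => //.
    apply: le_trans h1 _; rewrite lerD2l -mulrA ler_peMr//.
    rewrite /pker expr1n mul1r ler_pdivlMr ?mul1r; last by rewrite ltr_wpDl ?sqr_ge0.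
    rewrite lerD2r -(@real_normK _ x) ?num_real// ler_sqr ?nnegrE ?addr_ge0//.
    exact: hM.
  - apply: (L1Zl (c * N%:R)); apply: L1D => //.
    exact: (L1Zl (2 * B) (Int_pker1 R).1).
have /integrableP[_] : mu.-integrable A (EFin \o F).
  by apply/integrable_mkcond => //; rewrite restrict_EFin.
by [].
Qed.

(** The values of [g] at the endpoints are left free: the representing function [F] only takes
    default values there. *)
Lemma half_laplacian_eq_scaled (g : R -> R) :
  (forall x, g x = c * f (to_unit a b x) \/ `|to_unit a b x| = 1) ->
  half_laplacian_eq_on (~` [set a; b]) (fun x => U0 (to_unit a b x)) g.
Proof.
move=> gE; split.
  apply: Lfun2_sqr; first exact: measurable_to_unit.
  have LK : L1 (fun x => K * pker 1 x) by exact: (L1Zl K (Int_pker1 R).1).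
  apply: (@le_L1 _ _ (fun x => K * pker 1 (to_unit a b x))).
  - by apply: measurable_funX; exact: measurable_to_unit.
  - by move=> x; rewrite ger0_norm ?sqr_ge0.
  - exact: (L1_to_unit LK).
exists F; split; last first.
  move=> x /normr_to_unit_neq1; have [->//|->] := gE x.
  by rewrite eqxx.
split; first exact: F_locally_integrable.
move=> phi sphi.
(* The bound [U0_U] taken at height c e and divided by e. *)
pose G x := c * N%:R * 2 * jsing (to_unit a b x).
have [B B0 hB] := schwartz_decay sphi 0.
have Bx z : `|phi z| <= B.
  by apply: le_trans (hB z) _; rewrite ler_piMr// pker1_le1.
have pL := schwartz_L1 sphi.
have LG : L1 (fun x => G x * phi x).
  have [H LH hH] := jsing_to_unit.
  apply: (@le_L1 _ _ (fun x => c * N%:R * 2 * (H x * B + 2 * `|phi x|))).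
  - apply: measurable_funM; last exact: schwartz_measurable.
    apply: measurable_funM => //; apply: measurable_to_unit; exact: measurable_jsing.
  - move=> x; have [h0 h1] := hH x; have j0 := jsing_ge0 (to_unit a b x).
    have cN : 0 <= c * N%:R * 2 by rewrite mulr_ge0// mulr_ge0// ltW.
    rewrite normrM /G (ger0_norm (mulr_ge0 cN j0)) -mulrA; apply: ler_wpM2l => //.
    apply: (@le_trans _ _ ((H x + 2) * `|phi x|)); first exact: ler_wpM2r.
    by rewrite mulrDl lerD2r; exact: ler_wpM2l.
  - apply: (L1Zl (c * N%:R * 2)); apply: L1D; last exact: (L1Zl 2 (L1_norm pL)).
    by apply: (@eq_L1 _ (fun x => B * H x)); [move=> x; rewrite mulrC|exact: (L1Zl B LH)].
apply: (@poisson_half_laplacian R (fun x => U0 (to_unit a b x))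
  (fun e x => U (c * e) (to_unit a b x)) 1 _ _ _ phi sphi F G) => //.
- exact: measurable_to_unit.
- apply: aeS ae_to_unit => x x1 e e0.
  apply: le_trans (U0_U _ x1) _; first by rewrite mulr_gt0.
  by rewrite /G le_eqVlt; apply/orP; left; apply/eqP; ring.
- apply: aeS ae_to_unit => x x1.
  have hc : (c * harmonic m) @[m --> \oo] --> (0 : R).
    by rewrite -[X in _ --> X](mulr0 c); apply: cvgM; [exact: cvg_cst|exact: cvg_harmonic].
  have hp m : 0 < c * harmonic m :> R by rewrite mulr_gt0// harmonic_gt0.
  have E m : (U0 (to_unit a b x) - U (c * harmonic m) (to_unit a b x)) / harmonic m =
    c * ((U0 (to_unit a b x) - U (c * harmonic m) (to_unit a b x)) / (c * harmonic m)).
    have h0 : harmonic m != 0 :> R by rewrite lt0r_neq0// harmonic_gt0.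
    by field; rewrite h0 c_neq0.
  rewrite (funext E); apply: cvgM; first exact: cvg_cst.
  exact: U_cvg x1 hp hc.
Qed.

End Scaling.

(** * Verification of the hypotheses for Ttilde_n and W_n *)

Section Instances.
Variable R : realType.
Notation mu := (@lebesgue_measure R).
Notation Re := (@complex.Re R).
Notation Im := (@complex.Im R).
Notation normc := (@ComplexField.Normc.normc R).
Notation normcM := ComplexField.Normc.normcM.
Implicit Types x e : R.

Lemma measurable_normr_lt1 : measurable_fun setT (fun x : R => `|x| < 1).
Proof. by apply: measurable_fun_ltr => //; exact: normr_measurable. Qed.

Lemma measurable_chebV n : measurable_fun setT (@chebV R n).
Proof.
apply: measurable_funM; last first.
  by apply: continuous_measurable_fun; exact: continuous_horner.
apply: measurable_fun_ifT => //; first exact: measurable_normr_lt1.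
apply: (measurableT_comp (@measurable_inv R)).
by apply: (measurableT_comp (@measurable_sqrt R)); exact: measurable_funB.
Qed.

Let measurable_sqrt_sub1 : measurable_fun setT (fun x : R => (Num.sqrt (x ^+ 2 - 1))^-1).
Proof.
apply: (measurableT_comp (@measurable_inv R)).
by apply: (measurableT_comp (@measurable_sqrt R)); exact: measurable_funB.
Qed.

Lemma measurable_Utilde n : measurable_fun setT (@Utilde R n).
Proof.
suff : measurable_fun setT (@Utilde R n) /\ measurable_fun setT (@Utilde R n.+1) by case.
elim: n => [|n [IH1 IH2]]; split => //.
- apply: measurable_funD; first exact: measurable_Ttilde.
  apply: measurable_fun_ifT => //; first exact: (@measurable_le1 R).
  apply: (measurableT_comp (@oppr_measurable R setT)); apply: measurable_funM.
    exact: normr_measurable.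
  exact: measurable_sqrt_sub1.
- apply: measurable_funD.
    by apply: measurable_funM => //; exact: (@measurable_Ttilde R 1).
  apply: measurable_fun_ifT => //; first exact: (@measurable_le1 R).
  apply: (measurableT_comp (@oppr_measurable R setT)); apply: measurable_funM.
    exact: (@measurable_sg R).
  exact: measurable_sqrt_sub1.
- apply: measurable_funD => //.
  by apply: measurable_funM => //; exact: (@measurable_Ttilde R n.+2).
Qed.

Lemma pker1_ge x : `|x| <= 1 -> 1 <= 2 * pker 1 x.
Proof.
move=> x1; rewrite /pker expr1n mul1r ler_pdivlMr; last by rewrite ltr_wpDl ?sqr_ge0.
have : x ^+ 2 <= 1 by rewrite -real_normK ?num_real// expr_le1.
by lra.
Qed.

(** Outside [-1, 1], |w|^(n+1) <= |w| = 1 / |x + S| <= 1 / |x|. A positive exponent is essential, as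
    Ttilde_0 = 1 does not decay. *)
Lemma Ttilde_sqr_le n x : Ttilde n.+1 x ^+ 2 <= 2 * pker 1 x.
Proof.
have [x1|x1] := leP `|x| 1.
  apply: le_trans (pker1_ge x1).
  by rewrite -real_normK ?num_real// expr_le1// Ttilde_le1.
have x2 : 1 < x ^+ 2 by rewrite -real_normK ?num_real// exprn_egt1.
have w1 := jouk_norm_le1 x (lexx (0 : R)).
have Tw : `|Ttilde n.+1 x| <= normc (jouk x 0).
  rewrite Ttilde_jouk; apply: le_trans (normr_Re_le _) _.
  by rewrite exprS normcM ler_piMr ?normc_ge0// normc_exp_le1.
have vx : `|x| <= normc (Complex x 0 + jsqrt x 0).
  apply: le_trans (normr_Re_le _); rewrite cReD.
  rewrite -[Re (Complex x 0)]/x -ler_sqr ?nnegrE// !real_normK ?num_real//.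
  have := jsqrt_Re_ge0 x 0; have := sqr_ge0 (Re (jsqrt x 0)); set r := Re _.
  by rewrite sqrrD; lra.
have := congr1 normc (jouk_mul x (lexx (0 : R))).
rewrite normcM ComplexField.Normc.normc1 => wv.
have Tx : `|Ttilde n.+1 x| * `|x| <= 1 by rewrite -wv; apply: ler_pM.
have Tx2 : Ttilde n.+1 x ^+ 2 * x ^+ 2 <= 1.
  rewrite -(@real_normK _ (Ttilde _ x)) ?num_real// -(@real_normK _ x) ?num_real//.
  by rewrite -exprMn expr_le1// mulr_ge0.
rewrite /pker expr1n mul1r ler_pdivlMr; last by rewrite ltr_wpDl ?sqr_ge0.
by have := sqr_ge0 (Ttilde n.+1 x); nra.
Qed.

Lemma chebW_sqr_le n x : chebW n x ^+ 2 <= 2 * pker 1 x.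
Proof.
have [x1|x1] := leP `|x| 1.
  apply: le_trans (pker1_ge x1).
  by rewrite -real_normK ?num_real// expr_le1// normr_chebW_le1.
by rewrite (chebW_out _ (ltW x1)) expr0n mulr_ge0// pker_ge0.
Qed.

Lemma normc_jouk_div n x : normc (jouk x 0 ^+ n / jsqrt x 0) <= jsing x.
Proof.
rewrite normcM ComplexField.Normc.normcV ler_piMl ?invr_ge0 ?normc_ge0//.
by apply: normc_exp_le1; exact: jouk_norm_le1.
Qed.

Lemma chebV_le n x : `|n.+1%:R * chebV n.+1 x| <= n.+1%:R * jsing x.
Proof.
rewrite normrM normr_nat; apply: ler_wpM2l => //.
have [x1|x1] := eqVneq `|x| 1.
  by rewrite /chebV /weight_mhalf x1 ltxx mul0r normr0 jsing_ge0.
rewrite chebV_jouk// normrN; apply: le_trans (normr_Im_le _) _.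
exact: normc_jouk_div.
Qed.

(* The factor vanishes at the endpoints (x / 0 = 0) and is 1 elsewhere. *)
Definition Utilde0 n x : R := Utilde n x * ((x ^+ 2 - 1) / (x ^+ 2 - 1)).

Lemma Utilde0E n x : `|x| != 1 -> Utilde0 n x = Utilde n x.
Proof.
move=> x1; rewrite /Utilde0 divff ?mulr1//.
apply: contra x1; rewrite subr_eq0 => /eqP h.
by rewrite -(@eqrXn2 _ 2)// real_normK ?num_real// h expr1n.
Qed.

Lemma measurable_Utilde0 n : measurable_fun setT (Utilde0 n).
Proof.
apply: measurable_funM; first exact: measurable_Utilde.
apply: measurable_funM; first exact: measurable_funB.
by apply: (measurableT_comp (@measurable_inv R)); exact: measurable_funB.
Qed.

(** At the endpoints [jsing] is 0 whereas [Utilde] need not be; the bound holds there because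
    [Utilde0] vanishes. *)
Lemma Utilde0_le n x : `|n.+1%:R * Utilde0 n x| <= n.+1%:R * jsing x.
Proof.
rewrite normrM normr_nat; apply: ler_wpM2l => //.
have [x1|x1] := eqVneq `|x| 1.
  rewrite /Utilde0 -(@real_normK _ x) ?num_real// x1 expr1n subrr mul0r mulr0 normr0.
  exact: jsing_ge0.
rewrite Utilde0E// Utilde_jouk// normrN; apply: le_trans (normr_Re_le _) _.
exact: normc_jouk_div.
Qed.

Lemma jouk_exp_diff_le n e x : 0 < e -> `|x| != 1 ->
  normc (jouk x 0 ^+ n - jouk x e ^+ n) <= n%:R * (2 * jsing x * e).
Proof.
move=> e0 x1; have S0 := jsqrt0_neq0 x1.
rewrite -normcN opprB.
apply: le_trans (normc_expB_le _ (jouk_norm_le1 _ (ltW e0)) (jouk_norm_le1 _ (lexx _))) _.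
by apply: ler_wpM2l => //; apply: jouk_diff_norm => //; exact: ltW.
Qed.

Let ReMn n (z : R[i]) : Re (n%:R * z) = n%:R * Re z.
Proof.
elim: n => [|n IH]; first by rewrite !mul0r.
by rewrite -[n.+1%:R in LHS]natr1 -[n.+1%:R in RHS]natr1 !mulrDl !mul1r cReD IH.
Qed.

Let ImMn n (z : R[i]) : Im (n%:R * z) = n%:R * Im z.
Proof.
elim: n => [|n IH]; first by rewrite !mul0r.
by rewrite -[n.+1%:R in LHS]natr1 -[n.+1%:R in RHS]natr1 !mulrDl !mul1r cImD IH.
Qed.

Lemma Ttilde_slope n x (h : nat -> R) : `|x| != 1 -> (forall m, 0 < h m) ->
  h m @[m --> \oo] --> (0 : R) ->
  (Ttilde n.+1 x - Re (jouk x (h m) ^+ n.+1)) / h m @[m --> \oo] -->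
  n.+1%:R * chebV n.+1 x.
Proof.
move=> x1 hp hc; have [lim _] := cvg_jouk_exp n (jsqrt0_neq0 x1) hp hc.
move: lim; rewrite -mulrA ImMn -mulrN -chebV_jouk// -Ttilde_jouk; exact.
Qed.

Lemma chebW_slope n x (h : nat -> R) : `|x| != 1 -> (forall m, 0 < h m) ->
  h m @[m --> \oo] --> (0 : R) ->
  (chebW n x - - Im (jouk x (h m) ^+ n.+1)) / h m @[m --> \oo] -->
  n.+1%:R * Utilde0 n x.
Proof.
move=> x1 hp hc; have [_ lim] := cvg_jouk_exp n (jsqrt0_neq0 x1) hp hc.
rewrite Utilde0E// Utilde_jouk// mulrN -ReMn mulrA chebW_jouk.
have E m : (- Im (jouk x 0 ^+ n.+1) - - Im (jouk x (h m) ^+ n.+1)) / h m =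
    (Im (jouk x (h m) ^+ n.+1) - Im (jouk x 0 ^+ n.+1)) / h m by rewrite opprK addrC.
rewrite (funext E); exact: lim.
Qed.

End Instances.

Theorem proposition3p5 (R : realType) (a b : R) (hab : a < b) :
  (forall n : nat, (1 <= n)%N ->
     half_laplacian_eq_on (~` [set a; b]) (TtildeI a b n)
       (fun x => 2 * n%:R / (b - a) * chebVI a b n x)) /\
  (forall n : nat,
     half_laplacian_eq_on (~` [set a; b]) (chebWI a b n)
       (fun x => 2 * (n + 1)%:R / (b - a) * UtildeI a b n x)).
Proof.
split=> [[//|n] _|n].
- apply: (@half_laplacian_eq_scaled R a b hab n.+1 2 (Ttilde n.+1)
    (fun x => n.+1%:R * chebV n.+1 x) (fun e x => complex.Re (jouk x e ^+ n.+1))).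
  + exact: measurable_Ttilde.
  + exact: Ttilde_le1.
  + exact: Ttilde_sqr_le.
  + by move=> e x; exact: Int_Ttilde_pker.
  + move=> e x e0 x1; rewrite Ttilde_jouk -cReB.
    by apply: le_trans (normr_Re_le _) _; exact: jouk_exp_diff_le.
  + by move=> x h; exact: Ttilde_slope.
  + by apply: measurable_funM => //; exact: measurable_chebV.
  + exact: chebV_le.
  + by move=> x; left; rewrite /chebVI; ring.
- apply: (@half_laplacian_eq_scaled R a b hab n.+1 2 (chebW n)
    (fun x => n.+1%:R * Utilde0 n x) (fun e x => - complex.Im (jouk x e ^+ n.+1))).
  + exact: measurable_chebW.
  + exact: normr_chebW_le1.
  + exact: chebW_sqr_le.
  + by move=> e x; exact: Int_chebW_pker.
  + move=> e x e0 x1; rewrite chebW_jouk opprK addrC -opprB normrN -cImB.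
    by apply: le_trans (normr_Im_le _) _; exact: jouk_exp_diff_le.
  + by move=> x h; exact: chebW_slope.
  + by apply: measurable_funM => //; exact: measurable_Utilde0.
  + exact: Utilde0_le.
  (* [Utilde0] differs from [Utilde] only at the endpoints, which the second alternative exempts. *)
  + move=> x; have [x1|x1] := eqVneq `|to_unit a b x| 1; [by right|left].
    by rewrite /UtildeI Utilde0E// addn1; ring.
Qed.
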